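(* Let $X$ be a coalgebra over a field $k$. The assignment $s\mapsto\mathcal{X}_s=(X,\cdot_s,\mathbin{:}_s)$ is a bijective correspondence between left non-degenerate set-theoretic type solutions $s\colon X\otimes X\to X\otimes X$ of the braid equation and $q$-cycle coalgebras with underlying coalgebra $X$. Under this bijection, invertible solutions correspond to regular $q$-cycle coalgebras, while non-degenerate invertible solutions correspond to non-degenerate $q$-cycle coalgebras.
   Context: All vector spaces, maps and tensor products are over $k$ (maps are linear); Sweedler notation $\Delta(x)=x_{(1)}\otimes x_{(2)}$ is used; $\epsilon$ is the counit; $X^2=X\otimes X$; $X^{\mathrm{cop}}$ is the opposite coalgebra; $\tau$ is the flip; $X$ inside a tensor product of maps denotes $\mathrm{id}_X$. Solutions. For $s\colon X^2\to X^2$ put ${}^xy:=(X\otimes\epsilon)s(x\otimes y)$, $x^y:=(\epsilon\otimes X)s(x\otimes y)$ and $G_s(x\otimes y):=x^{y_{(1)}}\otimes y_{(2)}$. A coalgebra morphism $s$ is left non-degenerate if $G_s$ is invertible. Let $\tilde s$ be $s$ regarded as an endomorphism of $X^{\mathrm{cop}}\otimes X^{\mathrm{cop}}$ and $\tilde s_\tau:=\tau\circ\tilde s\circ\tau$; $s$ is right non-degenerate if $\tilde s_\tau$ is left non-degenerate (equivalently $x\otimes y\mapsto{}^{y_{(2)}}x\otimes y_{(1)}$ is invertible), and non-degenerate if it is left and right non-degenerate. A coalgebra endomorphism $s$ of $X^2$ is a set-theoretic type solution of the braid equation if $(s\otimes X)(X\otimes s)(s\otimes X)=(X\otimes s)(s\otimes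 X)(X\otimes s)$. For $s$ left non-degenerate, $x\cdot_s y:=(X\otimes\epsilon)G_s^{-1}(x\otimes y)$ and $x\mathbin{:}_sy:={}^{y\cdot_s x_{(1)}}x_{(2)}$. $q$-cycle coalgebras. A triple $\mathcal{X}=(X,\cdot,\mathbin{:})$, with linear maps $\cdot,\mathbin{:}\colon X^2\to X$ such that $\epsilon(x\cdot y)=\epsilon(x\mathbin{:}y)=\epsilon(x)\epsilon(y)$, is a $q$-magma coalgebra if $X\otimes X^{\mathrm{cop}}\to X^{\mathrm{cop}}\otimes X$, $x\otimes y\mapsto y_{(1)}\mathbin{:}x_{(2)}\otimes x_{(1)}\cdot y_{(2)}$, is a coalgebra morphism. It is left regular if $\overline G_{\mathcal X}\colon x\otimes y\mapsto x\cdot y_{(1)}\otimes y_{(2)}$ is invertible on $X^2$, right regular if $\overline G_{\mathcal X^{\mathrm{op}}}\colon x\otimes y\mapsto x\mathbin{:}y_{(2)}\otimes y_{(1)}$ is invertible, and regular if both hold. A $q$-cycle coalgebra is a left regular $q$-magma coalgebra such that for all $x,y,z\in X$: (1) $(x\cdot y_{(1)})\cdot(z\mathbin{:}y_{(2)})=(x\cdot z_{(2)})\cdot(y\cdot z_{(1)})$, (2) $(x\cdot y_{(1)})\mathbin{:}(z\cdot y_{(2)})=(x\mathbin{:}z_{(2)})\cdot(y\mathbin{:}z_{(1)})$, (3) $(x\mathbin{:}y_{(1)})\mathbin{:}(z\mathbin{:}y_{(2)})=(x\mathbin{:}z_{(2)})\mathbin{:}(y\cdot z_{(1)})$. Non-degeneracy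 of $\mathcal{X}$: if $\mathcal X$ is left regular put $x^y:=(X\otimes\epsilon)\overline G_{\mathcal X}^{-1}(x\otimes y)$ and ${}^xy:=y_{(2)}\mathbin{:}x^{y_{(1)}}$; $\mathcal X$ is right non-degenerate if it is left regular and $x\otimes y\mapsto{}^{y_{(2)}}x\otimes y_{(1)}$ is invertible. If $\mathcal X$ is right regular put $x_y:=(X\otimes\epsilon)\overline G_{\mathcal X^{\mathrm{op}}}^{-1}(x\otimes y)$ and ${}_xy:=y_{(1)}\cdot x_{y_{(2)}}$; $\mathcal X$ is left non-degenerate if it is right regular and $x\otimes y\mapsto{}_{y_{(1)}}x\otimes y_{(2)}$ is invertible. $\mathcal X$ is non-degenerate if it is left and right non-degenerate. *)

(* Defs.v *)
From HB Require Import structures.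
From mathcomp Require Import all_boot all_algebra.
From mathcomp Require Import boolp classical_sets functions.

Set Implicit Arguments.
Unset Strict Implicit.
Unset Printing Implicit Defensive.

Import GRing.Theory.
Local Open Scope ring_scope.
Local Open Scope quotient_scope.

Reserved Notation "V \ot W" (at level 40, left associativity).
Reserved Notation "v \ox w" (at level 40, left associativity).
Reserved Notation "f \om g" (at level 40, left associativity).

(* An element of the tensor product is a class of formal sums of pairs; two
   formal sums are identified when no bilinear map separates them.  This is the
   usual tensor product: see tliftE, tlift_uniq and tensor_sumE below. *)
Section TensorType.
Variables (k : fieldType) (V W : lmodType k).

Definition teval (U : lmodType k) (b : V -> W -> U) (s : seq (V * W)) : U :=
  \sum_(p <- s) b p.1 p.2.

Definition tequiv (s t : seq (V * W)) : bool :=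
  `[< forall (U : lmodType k) (b : {bilinear V -> W -> U}),
        teval b s = teval b t >].

Lemma tequivP s t : reflect (forall (U : lmodType k)
  (b : {bilinear V -> W -> U}), teval b s = teval b t) (tequiv s t).
Proof. exact: asboolP. Qed.

Lemma tequiv_is_equiv : equiv_class_of tequiv.
Proof.
split=> [s|s t|t s u]; first exact/tequivP.
  by apply/tequivP/tequivP => h U b; rewrite h.
by move=> /tequivP h1 /tequivP h2; apply/tequivP => U b; rewrite h1.
Qed.
Canonical tequiv_equiv := EquivRelPack tequiv_is_equiv.
Canonical tequiv_encModRel := defaultEncModRel tequiv.

Definition tensor : Type := {eq_quot tequiv}.
HB.instance Definition _ : EqQuotient _ tequiv tensor := EqQuotient.on tensor.
HB.instance Definition _ := Choice.on tensor.

Lemma tensor_eqP (s t : seq (V * W)) :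
  \pi_tensor s = \pi_tensor t <->
  forall (U : lmodType k) (b : {bilinear V -> W -> U}), teval b s = teval b t.
Proof. by split=> [/eqmodP/tequivP|h]; last exact/eqmodP/tequivP. Qed.

Lemma teval_repr (U : lmodType k) (b : {bilinear V -> W -> U}) s :
  teval b (repr (\pi_tensor s)) = teval b s.
Proof. by move: U b; apply/tensor_eqP; rewrite reprK. Qed.

Lemma teval_cat (U : lmodType k) (b : V -> W -> U) s t :
  teval b (s ++ t) = teval b s + teval b t.
Proof. exact: big_cat. Qed.

Lemma teval_scale (U : lmodType k) (b : {bilinear V -> W -> U}) a s :
  teval b [seq (a *: p.1, p.2) | p <- s] = a *: teval b s.
Proof.
rewrite /teval big_map scaler_sumr; apply: eq_bigr => p _ /=.
exact: linearZl_LR.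
Qed.

Definition tadd (x y : tensor) : tensor := \pi_tensor (repr x ++ repr y).
Definition tscale (a : k) (x : tensor) : tensor :=
  \pi_tensor [seq (a *: p.1, p.2) | p <- repr x].

Let tE (U : lmodType k) (b : {bilinear V -> W -> U}) :=
  (teval_repr b, teval_cat b, teval_scale b).

Lemma tensor_ind0 (P : tensor -> Prop) :
  (forall s, P (\pi_tensor s)) -> forall x, P x.
Proof. by move=> h x; rewrite -[x]reprK. Qed.

Lemma taddA : associative tadd.
Proof. by move=> x y z; apply/tensor_eqP => U b; rewrite !tE addrA. Qed.
Lemma taddC : commutative tadd.
Proof. by move=> x y; apply/tensor_eqP => U b; rewrite !tE addrC. Qed.
Lemma tadd0 : left_id (\pi_tensor [::]) tadd.
Proof.
elim/tensor_ind0 => s; apply/tensor_eqP => U b.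
by rewrite !tE /teval big_nil add0r.
Qed.
Lemma taddN : left_inverse (\pi_tensor [::]) (tscale (-1)) tadd.
Proof.
move=> x; apply/tensor_eqP => U b; rewrite !tE scaleN1r addNr.
by rewrite /teval big_nil.
Qed.
HB.instance Definition _ := GRing.isZmodule.Build tensor taddA taddC tadd0 taddN.

Lemma tscaleA a b x : tscale a (tscale b x) = tscale (a * b) x.
Proof. by apply/tensor_eqP => U c; rewrite !tE scalerA. Qed.
Lemma tscale1 : left_id 1 tscale.
Proof.
by elim/tensor_ind0 => s; apply/tensor_eqP => U b; rewrite !tE scale1r.
Qed.
Lemma tscaleDr : right_distributive tscale +%R.
Proof. by move=> a x y; apply/tensor_eqP => U b; rewrite !tE scalerDr. Qed.
Lemma tscaleDl x : {morph tscale^~ x : a b / a + b}.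
Proof. by move=> a b; apply/tensor_eqP => U c; rewrite !tE scalerDl. Qed.
HB.instance Definition _ := GRing.Zmodule_isLmodule.Build k tensor
  tscaleA tscale1 tscaleDr tscaleDl.

Definition tpure (v : V) (w : W) : tensor := \pi_tensor [:: (v, w)].

End TensorType.

Notation "V \ot W" := (tensor V W) : type_scope.
Notation "v \ox w" := (tpure v w) : ring_scope.
Notation bilin b := (bilinear_for *:%R *:%R b).

Section TensorTheory.
Variables (k : fieldType) (V W : lmodType k).

Lemma tpure_bilin : bilin (@tpure k V W).
Proof.
split=> [w a v v'|v a w w']; apply/tensor_eqP => U b.
  rewrite teval_cat !teval_repr teval_scale teval_repr.
  by rewrite /teval !big_seq1 /= linearDl linearZl_LR.
rewrite teval_cat !teval_repr teval_scale teval_repr.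
by rewrite /teval !big_seq1 /= linearDr linearZr_LR.
Qed.
HB.instance Definition _ :=
  bilinear_isBilinear.Build k V W (V \ot W) *:%R *:%R (@tpure k V W) tpure_bilin.

Lemma tensor_sumE (t : V \ot W) : t = \sum_(p <- repr t) p.1 \ox p.2.
Proof.
suff h s : \pi_(tensor V W) s = \sum_(p <- s) p.1 \ox p.2 by rewrite -h reprK.
elim: s => [|p s IH]; first by rewrite big_nil.
rewrite big_cons -IH; apply/tensor_eqP => U b.
by rewrite teval_cat !teval_repr /teval big_cons big_seq1.
Qed.

Section Lift.
Variables (U : lmodType k) (b : V -> W -> U).

Definition tlift_fun of bilin b := fun t : V \ot W => teval b (repr t).

Hypothesis bb : bilin b.
Let bbm := bilinear_isBilinear.Build k V W U *:%R *:%R b bb.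
Let bl : {bilinear V -> W -> U} := HB.pack b bbm.

Lemma tlift_is_linear : linear (tlift_fun bb).
Proof.
move=> a s t; rewrite /tlift_fun.
by rewrite -[b]/(bl : _ -> _) !teval_repr teval_cat teval_repr teval_scale.
Qed.
HB.instance Definition _ :=
  GRing.isLinear.Build k (V \ot W) U *:%R (tlift_fun bb) tlift_is_linear.

Definition tlift : {linear V \ot W -> U} := locked (tlift_fun bb : {linear _ -> _}).

Lemma tliftE v w : tlift (v \ox w) = b v w.
Proof.
rewrite /tlift -lock /= /tlift_fun -[b]/(bl : _ -> _) teval_repr.
by rewrite /teval big_seq1.
Qed.
End Lift.

Lemma tlift_uniq (U : lmodType k) (f g : {linear V \ot W -> U}) :
  (forall v w, f (v \ox w) = g (v \ox w)) -> f =1 g.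
Proof.
move=> h t; rewrite [t]tensor_sumE !linear_sum.
by apply: eq_bigr => p _.
Qed.

End TensorTheory.

Lemma linear_ext (k : fieldType) (V U : lmodType k) (f g : {linear V -> U}) :
  f =1 g -> f = g.
Proof.
case: f g => f cf [g cg] /= /funext fg; subst g; congr GRing.Linear.Pack.
case: cf cg => [[a] [b]] [[a'] [b']].
by rewrite (Prop_irrelevance a a') (Prop_irrelevance b b').
Qed.

Section TensorMaps.
Variable k : fieldType.
Implicit Types A B C D U V W : lmodType k.

Section Map.
Variables (V V' W W' : lmodType k).
Variables (f : {linear V -> V'}) (g : {linear W -> W'}).

Lemma tmap_bilin : bilin (fun v w => f v \ox g w).
Proof.
by split=> [w|v] a x y /=; rewrite linearP ?linearPl ?linearPr.
Qed.
Definition tmap : {linear V \ot W -> V' \ot W'} := tlift tmap_bilin.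
Lemma tmapE v w : tmap (v \ox w) = f v \ox g w.
Proof. exact: tliftE. Qed.
End Map.

Section Assoc.
Variables (U V W : lmodType k).

Lemma tswap_bilin : bilin (fun (v : V) (w : W) => w \ox v).
Proof. by split=> [w|v] a x y /=; rewrite ?linearPl ?linearPr. Qed.
Definition tswap : {linear V \ot W -> W \ot V} := tlift tswap_bilin.
Lemma tswapE v w : tswap (v \ox w) = w \ox v.
Proof. exact: tliftE. Qed.

Lemma tassoc1_bilin (w : W) : bilin (fun (u : U) (v : V) => u \ox (v \ox w)).
Proof. by split=> [v|u] a x y /=; rewrite ?linearPl ?linearPr. Qed.
Lemma tassoc_bilin : bilin (fun t w => tlift (tassoc1_bilin w) t).
Proof.
split=> [w|t] a x y; first exact: linearP.
rewrite [t]tensor_sumE !linear_sum /= scaler_sumr -big_split /=.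
by apply: eq_bigr => p _ /=; rewrite !tliftE !linearPr.
Qed.
Definition tassoc : {linear U \ot V \ot W -> U \ot (V \ot W)} :=
  tlift tassoc_bilin.
Lemma tassocE u v w : tassoc (u \ox v \ox w) = u \ox (v \ox w).
Proof. by rewrite !tliftE. Qed.

Lemma tassocV1_bilin (u : U) : bilin (fun (v : V) (w : W) => u \ox v \ox w).
Proof. by split=> [w|v] a x y /=; rewrite ?(linearPl, linearPr). Qed.
Lemma tassocV_bilin : bilin (fun u t => tlift (tassocV1_bilin u) t).
Proof.
split=> [t|u] a x y; last exact: linearP.
rewrite [t]tensor_sumE !linear_sum /= scaler_sumr -big_split /=.
by apply: eq_bigr => p _ /=; rewrite !tliftE !linearPl.
Qed.
Definition tassocV : {linear U \ot (V \ot W) -> U \ot V \ot W} :=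
  tlift tassocV_bilin.
Lemma tassocVE u v w : tassocV (u \ox (v \ox w)) = u \ox v \ox w.
Proof. by rewrite !tliftE. Qed.

Lemma tcontractl_bilin (e : {linear V -> k^o}) :
  bilin (fun (v : V) (w : W) => (e v : k) *: w).
Proof.
split=> [w|v] a x y /=; first by rewrite linearP scalerDl scalerA.
by rewrite scalerDr !scalerA mulrC.
Qed.
Definition tcontractl (e : {linear V -> k^o}) : {linear V \ot W -> W} :=
  tlift (tcontractl_bilin e).
Lemma tcontractlE e v w : tcontractl e (v \ox w) = (e v : k) *: w.
Proof. exact: tliftE. Qed.

Lemma tcontractr_bilin (e : {linear W -> k^o}) :
  bilin (fun (v : V) (w : W) => (e w : k) *: v).
Proof.
split=> [w|v] a x y /=; last by rewrite linearP scalerDl scalerA.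
by rewrite scalerDr !scalerA mulrC.
Qed.
Definition tcontractr (e : {linear W -> k^o}) : {linear V \ot W -> V} :=
  tlift (tcontractr_bilin e).
Lemma tcontractrE e v w : tcontractr e (v \ox w) = (e w : k) *: v.
Proof. exact: tliftE. Qed.
End Assoc.
End TensorMaps.

Arguments tmap {k V V' W W'} f g.
Arguments tswap {k V W}.
Arguments tassoc {k U V W}.
Arguments tassocV {k U V W}.
Arguments tcontractl {k V W} e.
Arguments tcontractr {k V W} e.
Notation "f \om g" := (tmap f g) : ring_scope.

Section MiddleFour.
Variables (k : fieldType) (A B C D : lmodType k).

Definition tmid4 : {linear (A \ot B) \ot (C \ot D) -> (A \ot C) \ot (B \ot D)} :=
  locked (tassocV \o (idfun \om (tassoc \o (tswap \om idfun) \o tassocV))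
            \o tassoc : {linear _ -> _}).
Lemma tmid4E a b c d : tmid4 ((a \ox b) \ox (c \ox d)) = (a \ox c) \ox (b \ox d).
Proof.
rewrite /tmid4 -lock /= tassocE tmapE /= tassocVE tmapE /= tswapE.
by rewrite tassocE tassocVE.
Qed.
End MiddleFour.
Arguments tmid4 {k A B C D}.

Lemma linear_inverse (k : fieldType) (V W : lmodType k) (f : {linear V -> W}) :
  bijective f -> exists g : {linear W -> V}, cancel f g /\ cancel g f.
Proof.
case=> g fK gK.
pose gm := GRing.isLinear.Build k W V *:%R g (can2_linear fK gK).
pose gl : {linear W -> V} := HB.pack g gm.
by exists gl.
Qed.

(* The inverse of a bijective linear map; it is 0 on the other linear maps. *)
Definition linv (k : fieldType) (V W : lmodType k) (f : {linear V -> W}) :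
    {linear W -> V} :=
  if pselect (bijective f) is left fbij then projT1 (cid (linear_inverse fbij))
  else \0.

Lemma linvP (k : fieldType) (V W : lmodType k) (f : {linear V -> W}) :
  bijective f -> cancel f (linv f) /\ cancel (linv f) f.
Proof.
by rewrite /linv; case: pselect => // fbij _; case: cid.
Qed.

Record coalgebra (k : fieldType) := Coalgebra {
  coalg_sort :> lmodType k;
  comul : {linear coalg_sort -> coalg_sort \ot coalg_sort};
  counit : {linear coalg_sort -> k^o};
  comulA : forall x, tassoc ((comul \om idfun) (comul x)) =
                     (idfun \om comul) (comul x);
  counitl : forall x, tcontractl counit (comul x) = x;
  counitr : forall x, tcontractr counit (comul x) = x
}.
Arguments comul {k} c.
Arguments counit {k} c.

(* The pairs occurring in Delta(x) = x_(1) \ox x_(2), for a fixed choice of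
   such an expression.  Sums of values of bilinear maps over these pairs do not
   depend on the choice, see sum_sweedler. *)
Definition sweedler (k : fieldType) (X : coalgebra k) (x : X) : seq (X * X) :=
  repr (comul X x).

Lemma sweedlerE (k : fieldType) (X : coalgebra k) (x : X) :
  comul X x = \sum_(p <- sweedler x) p.1 \ox p.2.
Proof. exact: tensor_sumE. Qed.

Lemma sum_sweedler (k : fieldType) (X : coalgebra k) (x : X) (U : lmodType k)
    (b : X -> X -> U) (bb : bilin b) :
  \sum_(p <- sweedler x) b p.1 p.2 = tlift bb (comul X x).
Proof.
by rewrite sweedlerE linear_sum; apply: eq_bigr => p _; rewrite tliftE.
Qed.

Section CoalgebraConstructions.
Variables (k : fieldType).
Implicit Types X Y : coalgebra k.

Definition coalg_morphism X Y (f : {linear X -> Y}) : Prop :=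
  (forall x, comul Y (f x) = (f \om f) (comul X x)) /\
  (forall x, counit Y (f x) = counit X x).

Section Cop.
Variable X : coalgebra k.
Definition cop_comul : {linear X -> X \ot X} := tswap \o comul X.

Lemma cop_comulA x : tassoc ((cop_comul \om idfun) (cop_comul x)) =
                     (idfun \om cop_comul) (cop_comul x).
Proof.
pose r : {linear X \ot (X \ot X) -> X \ot (X \ot X)} :=
  tassoc \o (tswap \om idfun) \o tswap.
have h1 (t : X \ot X) : tassoc ((cop_comul \om idfun) (tswap t)) =
    r ((idfun \om comul X) t).
  pose f : {linear X \ot X -> X \ot (X \ot X)} :=
    tassoc \o (cop_comul \om idfun) \o tswap.
  pose g : {linear X \ot X -> X \ot (X \ot X)} := r \o (idfun \om comul X).
  rewrite -[LHS]/(f t) -[RHS]/(g t); apply: tlift_uniq => v w.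
  by rewrite /= !(tswapE, tmapE).
have h2 (t : X \ot X) : (idfun \om cop_comul) (tswap t) =
    r (tassoc ((comul X \om idfun) t)).
  pose f : {linear X \ot X -> X \ot (X \ot X)} :=
    (idfun \om cop_comul) \o tswap.
  pose g : {linear X \ot X -> X \ot (X \ot X)} :=
    r \o tassoc \o (comul X \om idfun).
  rewrite -[LHS]/(f t) -[RHS]/(g t); apply: tlift_uniq => v w.
  rewrite /= tswapE !tmapE /= (tensor_sumE (comul X v)).
  rewrite !(linear_sum, linear_sumlz, linear_sumr).
  apply: eq_bigr => p _ /=.
  by rewrite !(tassocE, tswapE, tmapE).
by rewrite [in LHS]/= h1 -comulA -h2.
Qed.

Lemma cop_counitl x : tcontractl (counit X) (cop_comul x) = x.
Proof.
rewrite -[RHS](counitr x) /= (tensor_sumE (comul X x)) !linear_sum.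
by apply: eq_bigr => p _; rewrite tswapE tcontractlE tcontractrE.
Qed.

Lemma cop_counitr x : tcontractr (counit X) (cop_comul x) = x.
Proof.
rewrite -[RHS](counitl x) /= (tensor_sumE (comul X x)) !linear_sum.
by apply: eq_bigr => p _; rewrite tswapE tcontractlE tcontractrE.
Qed.

Definition cop : coalgebra k := Coalgebra cop_comulA cop_counitl cop_counitr.
End Cop.

Section Tensor.
Variables X Y : coalgebra k.

Definition tens_comul : {linear X \ot Y -> (X \ot Y) \ot (X \ot Y)} :=
  tmid4 \o (comul X \om comul Y).

Lemma tens_counit_bilin :
  bilin (fun (x : X) (y : Y) => (counit X x * counit Y y : k^o)).
Proof.
split=> [y|x] a u v /=; rewrite linearP; first by rewrite mulrDl -scalerAl.
by rewrite mulrDr -scalerAr.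
Qed.
Definition tens_counit : {linear X \ot Y -> k^o} := tlift tens_counit_bilin.

Lemma tens_comulA t : tassoc ((tens_comul \om idfun) (tens_comul t)) =
                      (idfun \om tens_comul) (tens_comul t).
Proof.
pose f1 : {linear X \ot Y -> _} :=
  tassoc \o (tens_comul \om idfun) \o tens_comul.
pose g1 : {linear X \ot Y -> _} := (idfun \om tens_comul) \o tens_comul.
rewrite -[LHS]/(f1 t) -[RHS]/(g1 t); apply: tlift_uniq => x y {t}.
pose m1 : {linear (X \ot (X \ot X)) \ot (Y \ot (Y \ot Y)) -> _} :=
  (idfun \om tmid4) \o tmid4.
have h1 (a : X \ot X) (b : Y \ot Y) :
    tassoc ((tens_comul \om idfun) (tmid4 (a \ox b))) =
    m1 (tassoc ((comul X \om idfun) a) \ox tassoc ((comul Y \om idfun) b)).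
  rewrite (tensor_sumE a) (tensor_sumE b).
  rewrite !(linear_sum, linear_sumlz); apply: eq_bigr => p _.
  rewrite !(linear_sum, linear_sumr); apply: eq_bigr => q _.
  rewrite tmid4E !tmapE /= tmapE.
  rewrite (tensor_sumE (comul X p.1)) (tensor_sumE (comul Y q.1)).
  rewrite !(linear_sum, linear_sumlz); apply: eq_bigr => u _.
  rewrite !(linear_sum, linear_sumlz, linear_sumr); apply: eq_bigr => v _.
  by rewrite /= !(tmid4E, tassocE, tmapE) /= ?(tmid4E, tassocE, tmapE).
have h2 (a : X \ot X) (b : Y \ot Y) :
    (idfun \om tens_comul) (tmid4 (a \ox b)) =
    m1 ((idfun \om comul X) a \ox (idfun \om comul Y) b).
  rewrite (tensor_sumE a) (tensor_sumE b).
  rewrite !(linear_sum, linear_sumlz); apply: eq_bigr => p _.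
  rewrite !(linear_sum, linear_sumr); apply: eq_bigr => q _.
  by rewrite !(tmid4E, tmapE) /= !(tmid4E, tmapE).
rewrite /f1 /g1 [in LHS]/= [in RHS]/= !tmapE h1 h2.
by rewrite !comulA.
Qed.

Lemma tens_counitl t : tcontractl tens_counit (tens_comul t) = t.
Proof.
pose f : {linear X \ot Y -> X \ot Y} := tcontractl tens_counit \o tens_comul.
rewrite -[LHS]/(f t) -[RHS]/((idfun : {linear _ -> _}) t).
apply: tlift_uniq => x y {t}; rewrite /= tmapE.
rewrite -[in RHS](counitl x) -[in RHS](counitl y).
rewrite (tensor_sumE (comul X x)) (tensor_sumE (comul Y y)).
rewrite !(linear_sum, linear_sumlz); apply: eq_bigr => p _.
rewrite !(linear_sum, linear_sumr); apply: eq_bigr => q _.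
by rewrite tmid4E !tcontractlE tliftE /= linearZl_LR /= linearZr_LR scalerA.
Qed.

Lemma tens_counitr t : tcontractr tens_counit (tens_comul t) = t.
Proof.
pose f : {linear X \ot Y -> X \ot Y} := tcontractr tens_counit \o tens_comul.
rewrite -[LHS]/(f t) -[RHS]/((idfun : {linear _ -> _}) t).
apply: tlift_uniq => x y {t}; rewrite /= tmapE.
rewrite -[in RHS](counitr x) -[in RHS](counitr y).
rewrite (tensor_sumE (comul X x)) (tensor_sumE (comul Y y)).
rewrite !(linear_sum, linear_sumlz); apply: eq_bigr => p _.
rewrite !(linear_sum, linear_sumr); apply: eq_bigr => q _.
by rewrite tmid4E !tcontractrE tliftE /= linearZl_LR /= linearZr_LR scalerA.
Qed.

Definition tens : coalgebra k :=
  Coalgebra tens_comulA tens_counitl tens_counitr.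
End Tensor.

End CoalgebraConstructions.
Arguments coalg_morphism {k} X Y f.

Section Solutions.
Variables (k : fieldType) (X : coalgebra k).
Implicit Types (m : {linear X \ot X -> X}) (s : {linear X \ot X -> X \ot X}).

(* x \ox y |-> m (x \ox y_(1)) \ox y_(2) *)
Definition Gmap m : {linear X \ot X -> X \ot X} :=
  (m \om idfun) \o tassocV \o (idfun \om comul X).

Lemma GmapE m x y :
  Gmap m (x \ox y) = \sum_(p <- sweedler y) m (x \ox p.1) \ox p.2.
Proof.
rewrite /= tmapE sweedlerE linear_sumr !linear_sum; apply: eq_bigr => p _ /=.
by rewrite tassocVE tmapE.
Qed.

(* x \ox y |-> ^x y *)
Definition lact s : {linear X \ot X -> X} := tcontractr (counit X) \o s.
(* x \ox y |-> x^y *)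
Definition ract s : {linear X \ot X -> X} := tcontractl (counit X) \o s.

Definition left_nondeg s : Prop :=
  coalg_morphism (tens X X) (tens X X) s /\ bijective (Gmap (ract s)).

Definition braid_equation s : Prop :=
  let s12 : {linear X \ot X \ot X -> X \ot X \ot X} := s \om idfun in
  let s23 : {linear X \ot X \ot X -> X \ot X \ot X} :=
    tassocV \o (idfun \om s) \o tassoc in
  forall t : X \ot X \ot X, s12 (s23 (s12 t)) = s23 (s12 (s23 t)).

Definition braid_solution s : Prop :=
  coalg_morphism (tens X X) (tens X X) s /\ braid_equation s.

(* x \ox y |-> x ._s y *)
Definition sdot s : {linear X \ot X -> X} :=
  tcontractr (counit X) \o linv (Gmap (ract s)).
(* x \ox y |-> x :_s y *)
Definition scolon s : {linear X \ot X -> X} :=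
  lact s \o Gmap (sdot s) \o tswap.

Lemma scolonE s x y : scolon s (x \ox y) =
  \sum_(p <- sweedler x) lact s (sdot s (y \ox p.1) \ox p.2).
Proof.
rewrite -[LHS]/(lact s (Gmap (sdot s) (tswap (x \ox y)))).
by rewrite tswapE GmapE linear_sum.
Qed.

End Solutions.

Definition right_nondeg (k : fieldType) (X : coalgebra k)
    (s : {linear X \ot X -> X \ot X}) : Prop :=
  @left_nondeg k (cop X) (tswap \o s \o tswap).

Definition nondeg (k : fieldType) (X : coalgebra k)
    (s : {linear X \ot X -> X \ot X}) : Prop :=
  left_nondeg s /\ right_nondeg s.

(* The map Gmap of X^cop is x \ox y |-> m (x \ox y_(2)) \ox y_(1), where the
   Sweedler indices are those of X. *)
Lemma Gmap_copE (k : fieldType) (X : coalgebra k) (m : {linear X \ot X -> X})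
    (x y : X) :
  @Gmap k (cop X) m (x \ox y) = \sum_(p <- sweedler y) m (x \ox p.2) \ox p.1.
Proof.
rewrite [LHS]/= tmapE /= sweedlerE !linear_sum linear_sumr !linear_sum.
by apply: eq_bigr => p _ /=; rewrite tswapE tassocVE tmapE.
Qed.

Record qpair (k : fieldType) (X : coalgebra k) := Qpair {
  qdot : {linear X \ot X -> X};
  qcolon : {linear X \ot X -> X}
}.

Section QCycle.
Variables (k : fieldType) (X : coalgebra k).
Implicit Type q : qpair X.

(* (x1 \ox x2) \ox (y1 \ox y2) |-> (y1 \ox x2) \ox (x1 \ox y2) *)
Definition qshuffle :
    {linear (X \ot X) \ot (X \ot X) -> (X \ot X) \ot (X \ot X)} :=
  (tswap \om idfun) \o tmid4 \o (tswap \om idfun).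

(* x \ox y |-> (y_(1) : x_(2)) \ox (x_(1) . y_(2)) *)
Definition qmap q : {linear X \ot X -> X \ot X} :=
  (qcolon q \om qdot q) \o qshuffle \o (comul X \om comul X).

Lemma qmapE q x y : qmap q (x \ox y) =
  \sum_(u <- sweedler x) \sum_(v <- sweedler y)
    qcolon q (v.1 \ox u.2) \ox qdot q (u.1 \ox v.2).
Proof.
rewrite [LHS]/= !tmapE /= (sweedlerE x) (sweedlerE y).
rewrite !(linear_sum, linear_sumlz); apply: eq_bigr => u _.
rewrite !(linear_sum, linear_sumr); apply: eq_bigr => v _ /=.
by rewrite tswapE tmid4E tmapE /= tswapE tmapE.
Qed.

Definition qmagma_coalgebra q : Prop :=
  [/\ forall x y, counit X (qdot q (x \ox y)) = counit X x * counit X y :> k,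
      forall x y, counit X (qcolon q (x \ox y)) = counit X x * counit X y :> k
    & coalg_morphism (tens X (cop X)) (tens (cop X) X) (qmap q)].

Definition qleft_regular q : Prop := bijective (Gmap (qdot q)).
Definition qright_regular q : Prop := bijective (@Gmap k (cop X) (qcolon q)).
Definition qregular q : Prop := qleft_regular q /\ qright_regular q.

Definition qcycle_coalgebra q : Prop :=
  let dot x y := qdot q (x \ox y) in
  let colon x y := qcolon q (x \ox y) in
  [/\ qmagma_coalgebra q,
      qleft_regular q,
      forall x y z : X,
        \sum_(u <- sweedler y) dot (dot x u.1) (colon z u.2) =
        \sum_(v <- sweedler z) dot (dot x v.2) (dot y v.1),
      forall x y z : X,
        \sum_(u <- sweedler y) colon (dot x u.1) (dot z u.2) =
        \sum_(v <- sweedler z) dot (colon x v.2) (colon y v.1)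
    & forall x y z : X,
        \sum_(u <- sweedler y) colon (colon x u.1) (colon z u.2) =
        \sum_(v <- sweedler z) colon (colon x v.2) (dot y v.1)].

(* x \ox y |-> x^y and x \ox y |-> ^x y = y_(2) : x^(y_(1)) *)
Definition qract q : {linear X \ot X -> X} :=
  tcontractr (counit X) \o linv (Gmap (qdot q)).
Definition qlact q : {linear X \ot X -> X} :=
  qcolon q \o tswap \o Gmap (qract q).

Lemma qlactE q x y : qlact q (x \ox y) =
  \sum_(p <- sweedler y) qcolon q (p.2 \ox qract q (x \ox p.1)).
Proof.
rewrite -[LHS]/(qcolon q (tswap (Gmap (qract q) (x \ox y)))) GmapE !linear_sum.
by apply: eq_bigr => p _; rewrite tswapE.
Qed.

(* x \ox y |-> x_y and x \ox y |-> _x y = y_(1) . x_(y_(2)) *)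
Definition qrsub q : {linear X \ot X -> X} :=
  tcontractr (counit X) \o linv (@Gmap k (cop X) (qcolon q)).
Definition qlsub q : {linear X \ot X -> X} :=
  qdot q \o tswap \o @Gmap k (cop X) (qrsub q).

Lemma qlsubE q x y : qlsub q (x \ox y) =
  \sum_(p <- sweedler y) qdot q (p.1 \ox qrsub q (x \ox p.2)).
Proof.
rewrite -[LHS]/(qdot q (tswap (@Gmap k (cop X) (qrsub q) (x \ox y)))).
by rewrite Gmap_copE !linear_sum; apply: eq_bigr => p _; rewrite tswapE.
Qed.

(* The second condition is invertibility of x \ox y |-> ^(y_(2)) x \ox y_(1). *)
Definition qright_nondeg q : Prop :=
  qleft_regular q /\ bijective (@Gmap k (cop X) (qlact q \o tswap)).
(* The second condition is invertibility of x \ox y |-> _(y_(1)) x \ox y_(2). *)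
Definition qleft_nondeg q : Prop :=
  qright_regular q /\ bijective (Gmap (qlsub q \o tswap)).
Definition qnondeg q : Prop :=
  qleft_nondeg q /\ qright_nondeg q.

End QCycle.

Definition qpair_of (k : fieldType) (X : coalgebra k)
    (s : {linear X \ot X -> X \ot X}) : qpair X := Qpair (sdot s) (scolon s).

(* Main.v *)
From HB Require Import structures.
Require Import Defs.
From mathcomp Require Import all_boot all_algebra.
From mathcomp Require Import classical_sets functions.

(** Write x^y and ^x y for the two components of a coalgebra endomorphism s of
X (x) X, and G for x (x) y |-> x^(y_1) (x) y_2.  A left non-degenerate s and its
pair (., :) determine each other, because x . y is the convolution inverse of
x^y in the variable y (the inverse of G is x (x) y |-> x . y_1 (x) y_2) and

  y : x = ^(x . y_1) y_2,      ^x y = y_2 : x^(y_1).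

That s is a coalgebra morphism means that both components are comultiplicative
and that they cocommute; convolution inversion turns this into the same
statement about (., :) with the coproduct of the acted-on variable reversed,
which is the definition of a q-magma coalgebra.  As the passage is symmetric, one
lemma, crossing_inv, yields both directions, and the relation dual gathers
the outcome: it is a bijection between left non-degenerate coalgebra morphisms
and left regular q-magma coalgebras.

It remains to match the braid equation with the three q-cycle identities.  A
coalgebra morphism into a tensor product is determined by its components
(morphism_ext), so that the braid equation splits into three equations with
values in X (braid_components); they are, with u (x) v = s(a (x) b) and
w (x) t = s(b (x) x),

  ^a(^b x) = ^u(^v x),   u^(^v x) = ^(a^w) t,   (a^b)^x = (a^w)^t.

The third says that the family of operators a |-> (a^b)^x, indexed by b (x) x, is
invariant under s; then so is its convolution inverse, and substituting
y . z_1 (x) z_2 for b (x) x turns this invariance into the first q-cycle identity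
(braid3_qcycle1).  Given the third equation, the second one takes a mixed form
which convolution inversion identifies with the second q-cycle identity, and
given both, the first one is the third q-cycle identity precomposed with a
bijection of X^3 (braid1_qcycle3).  In each case the substitution is by an
invertible operator, so that the implications are equivalences.

Finally s = K o tau o G, where K : x (x) y |-> x : y_2 (x) y_1 is the operator
whose invertibility is right regularity (sol_factor).  Hence s is invertible
exactly when the pair is regular.  In that case the inverse of s has components
_x y and x_y, and each of the two conditions in the non-degeneracy of the pair
amounts to the invertibility of x (x) y |-> ^(y_2) x (x) y_1, as does the right
non-degeneracy of s.

The computations are in Sweedler notation: \sw_(a, b <- t) E sums E over
expressions t = a (x) b, and a linearity tactic discharges the multilinearity
that makes such sums meaningful. *)

Set Implicit Arguments.
Unset Strict Implicit.
Unset Printing Implicit Defensive.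

Import GRing.Theory.
Local Open Scope ring_scope.

(** * Sums over tensors *)

Section Tsum.
Variable k : fieldType.
Implicit Types U V W : lmodType k.

(** For bilinear F this is the value at t of the linear map induced by F.
Keeping F a plain function allows F to be an expression in the two legs, with
bilinearity proved only where it is needed. *)
Definition tsum V W U (t : V \ot W) (F : V -> W -> U) : U :=
  \sum_(p <- repr t) F p.1 p.2.

End Tsum.
Notation "\sw_ ( a , b <- t ) E" := (tsum t (fun a b => E))
  (at level 41, E at level 41, a name, b name, t at level 50,
   format "'[' \sw_ ( a ,  b  <-  t ) '/  '  E ']'") : ring_scope.

Section TsumTheory.
Variable k : fieldType.
Implicit Types U V W : lmodType k.

Lemma tsumE V W U (t : V \ot W) (F : V -> W -> U) (bF : bilin F) :
  tsum t F = tlift bF t.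
Proof.
rewrite [t in RHS]tensor_sumE linear_sum.
by apply: eq_bigr => p _; rewrite tliftE.
Qed.

(** The rules of the tactic lin, one for each way of building an expression. *)
Lemma lin_id V : linear (fun x : V => x). Proof. by []. Qed.
Lemma lin_app V W U (f : {linear W -> U}) (g : V -> W) :
  linear g -> linear (fun x => f (g x)).
Proof. by move=> lg a x y; rewrite lg linearP. Qed.
Lemma lin_pureL V W U (g : V -> W) (u : U) :
  linear g -> linear (fun x => g x \ox u).
Proof. by move=> lg a x y; rewrite lg linearPl. Qed.
Lemma lin_pureR V W U (g : V -> W) (u : U) :
  linear g -> linear (fun x => u \ox g x).
Proof. by move=> lg a x y; rewrite lg linearPr. Qed.
Lemma lin_tsum V W W' U (t : W \ot W') (F : V -> W -> W' -> U) :
  (forall a b, linear (fun x => F x a b)) -> linear (fun x => tsum t (F x)).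
Proof.
move=> lF a x y; rewrite /tsum scaler_sumr -big_split.
by apply: eq_bigr => p _; rewrite lF.
Qed.
Lemma lin_tsum_arg V W W' U (t : V -> W \ot W') (F : W -> W' -> U) :
  bilin F -> linear t -> linear (fun x => tsum (t x) F).
Proof. by move=> bF lt a x y; rewrite !tsumE lt linearP. Qed.
Lemma lin_scale V W U (e : {linear W -> k^o}) (g : V -> W) (u : U) :
  linear g -> linear (fun x => (e (g x) : k) *: u).
Proof. by move=> lg a x y; rewrite lg linearP scalerDl scalerA. Qed.
Lemma lin_scaler V U (c : k) (g : V -> U) :
  linear g -> linear (fun x => c *: g x).
Proof. by move=> lg a x y; rewrite lg scalerDr !scalerA mulrC. Qed.
Lemma lin_bilL V W W' U (F : W -> W' -> U) (g : V -> W) w :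
  bilin F -> linear g -> linear (fun x => F (g x) w).
Proof. by case=> lF _ lg a x y; rewrite lg; apply: lF. Qed.
Lemma lin_bilR V W W' U (F : W -> W' -> U) (g : V -> W') w :
  bilin F -> linear g -> linear (fun x => F w (g x)).
Proof. by case=> _ lF lg a x y; rewrite lg; apply: lF. Qed.

Definition trilin V W W' U (F : V -> W -> W' -> U) : Prop :=
  [/\ forall b c, linear (fun a => F a b c),
      forall a c, linear (fun b => F a b c)
    & forall a b, linear (F a b)].
Lemma lin_tri1 V0 V W W' U (F : V -> W -> W' -> U) (g : V0 -> V) b c :
  trilin F -> linear g -> linear (fun x => F (g x) b c).
Proof. by case=> lF _ _ lg a x y; rewrite lg; apply: lF. Qed.
Lemma lin_tri2 V0 V W W' U (F : V -> W -> W' -> U) (g : V0 -> W) b c :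
  trilin F -> linear g -> linear (fun x => F b (g x) c).
Proof. by case=> _ lF _ lg a x y; rewrite lg; apply: lF. Qed.
Lemma lin_tri3 V0 V W W' U (F : V -> W -> W' -> U) (g : V0 -> W') b c :
  trilin F -> linear g -> linear (fun x => F b c (g x)).
Proof. by case=> _ _ lF lg a x y; rewrite lg; apply: lF. Qed.
Lemma lin_fun V W U (F : W -> U) (g : V -> W) :
  linear F -> linear g -> linear (fun x => F (g x)).
Proof. by move=> lF lg a x y; rewrite lg lF. Qed.
End TsumTheory.

(** Proves linearity, bilinearity or trilinearity of an expression by following
its syntax; the partially applied forms are there because unification returns
eta-contracted functions. *)
Ltac lin_step :=
  lazymatch goal with
  | |- bilinear_for _ _ _ => split => [? | ?]
  | |- trilin _ => split => [? ? | ? ? | ? ?]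
  | |- GRing.linear_for _ _ =>
    match goal with
    | |- GRing.linear_for _ (fun x => x) => exact: lin_id
    | H : GRing.linear_for _ ?F |- GRing.linear_for _ ?F => exact: H
    | |- GRing.linear_for _ (GRing.Linear.sort ?f) =>
        exact: (lin_app f (@lin_id _ _))
    | |- GRing.linear_for _ (tpure ?u) =>
        exact: (lin_pureR u (@lin_id _ _))
    | |- GRing.linear_for _ ( *:%R ?c) =>
        exact: (lin_scaler c (@lin_id _ _))
    | |- GRing.linear_for _ (fun x => tsum ?t (@?F x)) =>
        apply: lin_tsum => ? ?
    | |- GRing.linear_for _ (fun x => tsum (@?t x) ?F) =>
        apply: lin_tsum_arg
    | |- GRing.linear_for _ (fun x => ?u \ox @?g x) => apply: lin_pureR
    | |- GRing.linear_for _ (fun x => @?g x \ox ?u) => apply: lin_pureL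
    | |- GRing.linear_for _ (fun x => ?c *: @?g x) => apply: lin_scaler
    | |- GRing.linear_for _ (fun x => GRing.Linear.sort ?e (@?g x) *: ?u) =>
        apply: lin_scale
    | |- GRing.linear_for _ (fun x => GRing.Linear.sort ?f (@?g x)) =>
        apply: lin_app
    | H : bilinear_for _ _ ?F |- GRing.linear_for _ (?F ?u) =>
        exact: (snd H u)
    | H : bilinear_for _ _ ?F |- GRing.linear_for _ (fun x => ?F (@?g x) ?w) =>
        apply: (lin_bilL _ H)
    | H : bilinear_for _ _ ?F |- GRing.linear_for _ (fun x => ?F ?w (@?g x)) =>
        apply: (lin_bilR _ H)
    | H : trilin ?F |- GRing.linear_for _ (?F ?u ?v) => by case: H
    | H : trilin ?F |- GRing.linear_for _ (fun x => ?F (@?g x) ?v ?w) =>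
        apply: (lin_tri1 _ _ H)
    | H : trilin ?F |- GRing.linear_for _ (fun x => ?F ?v (@?g x) ?w) =>
        apply: (lin_tri2 _ _ H)
    | H : trilin ?F |- GRing.linear_for _ (fun x => ?F ?v ?w (@?g x)) =>
        apply: (lin_tri3 _ _ H)
    | H : GRing.linear_for _ ?F |- GRing.linear_for _ (fun x => ?F (@?g x)) =>
        apply: (lin_fun H)
    end
  end.
Ltac lin := repeat (cbv beta; lin_step).

Section TsumRules.
Variable k : fieldType.
Implicit Types U V W : lmodType k.

Lemma eq_tsum V W U (t : V \ot W) (F G : V -> W -> U) :
  (forall a b, F a b = G a b) -> tsum t F = tsum t G.
Proof. by move=> FG; apply: eq_bigr. Qed.

Lemma tsum_pure V W U (F : V -> W -> U) v w : bilin F ->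
  tsum (v \ox w) F = F v w.
Proof. by move=> bF; rewrite tsumE tliftE. Qed.

Lemma tsum_tens V W (t : V \ot W) : \sw_(a, b <- t) a \ox b = t.
Proof. by rewrite [RHS]tensor_sumE. Qed.

Lemma linear_tsum V W U U' (f : {linear U -> U'}) (t : V \ot W)
    (F : V -> W -> U) :
  f (tsum t F) = \sw_(a, b <- t) f (F a b).
Proof. exact: linear_sum. Qed.

Lemma lin_tsumE V W U U' (t : V \ot W) (F : V -> W -> U) (f : U -> U') :
  linear f -> f (tsum t F) = \sw_(a, b <- t) f (F a b).
Proof.
move=> lf; pose flm := GRing.isLinear.Build k U U' *:%R f lf.
pose fl : {linear U -> U'} := HB.pack f flm.
exact: (linear_tsum fl).
Qed.

Lemma lin_scaleE U U' (f : U -> U') a u : linear f -> f (a *: u) = a *: f u.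
Proof.
move=> lf; pose flm := GRing.isLinear.Build k U U' *:%R f lf.
pose fl : {linear U -> U'} := HB.pack f flm.
exact: (linearZ_LR fl).
Qed.

Lemma tens_tsuml V W U U' (t : V \ot W) (F : V -> W -> U) (u : U') :
  tsum t F \ox u = \sw_(a, b <- t) F a b \ox u.
Proof. exact: linear_sumlz. Qed.

Lemma tens_tsumr V W U U' (t : V \ot W) (F : V -> W -> U) (u : U') :
  u \ox tsum t F = \sw_(a, b <- t) u \ox F a b.
Proof. exact: linear_sumr. Qed.

Lemma tsum_tsum V W V' W' U (t : V \ot W) (F : V -> W -> V' \ot W')
    (H : V' -> W' -> U) : bilin H ->
  tsum (tsum t F) H = \sw_(a, b <- t) tsum (F a b) H.
Proof.
by move=> bH; rewrite tsumE linear_tsum; apply: eq_tsum => a b; rewrite tsumE.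
Qed.

Lemma tsum_om V W V' W' U (f : {linear V -> V'}) (g : {linear W -> W'}) t
    (H : V' -> W' -> U) : bilin H ->
  tsum ((f \om g) t) H = \sw_(a, b <- t) H (f a) (g b).
Proof.
move=> bH; rewrite -[t in LHS]tsum_tens linear_tsum tsum_tsum //.
by apply: eq_tsum => a b; rewrite tmapE tsum_pure.
Qed.

Lemma tsum_swap V W U (t : V \ot W) (H : W -> V -> U) : bilin H ->
  tsum (tswap t) H = \sw_(a, b <- t) H b a.
Proof.
move=> bH; rewrite -[t in LHS]tsum_tens linear_tsum tsum_tsum //.
by apply: eq_tsum => a b; rewrite tswapE tsum_pure.
Qed.

Lemma tswapK V W : cancel (@tswap k V W) tswap.
Proof.
move=> t; rewrite -[t]tsum_tens !linear_tsum.
by apply: eq_tsum => *; rewrite !tswapE.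
Qed.

Lemma tsum_exch V W V' W' U (t : V \ot W) (t' : V' \ot W')
    (F : V -> W -> V' -> W' -> U) :
  \sw_(a, b <- t) \sw_(c, d <- t') F a b c d =
  \sw_(c, d <- t') \sw_(a, b <- t) F a b c d.
Proof. exact: exchange_big. Qed.

Lemma tlin_ext V W U (f g : V \ot W -> U) : linear f -> linear g ->
  (forall v w, f (v \ox w) = g (v \ox w)) -> f =1 g.
Proof.
move=> lf lg fg t; rewrite -[t]tsum_tens (lin_tsumE _ _ lf) (lin_tsumE _ _ lg).
by apply: eq_tsum.
Qed.

Lemma tscalel V W (c : k) (v : V) (w : W) : (c *: v) \ox w = c *: (v \ox w).
Proof. exact: linearZl_LR. Qed.

Lemma tscaler V W (c : k) (v : V) (w : W) : v \ox (c *: w) = c *: (v \ox w).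
Proof. exact: linearZr_LR. Qed.

Lemma tmap_tswap V W (h : {linear V -> W}) t :
  (h \om h) (tswap t) = tswap ((h \om h) t).
Proof.
move: t; apply: tlin_ext => [||u v]; try by lin.
by rewrite !(tswapE, tmapE).
Qed.

Lemma tcontractl_swap V W (e : {linear V -> k^o}) (t : W \ot V) :
  tcontractl e (tswap t) = tcontractr e t.
Proof.
move: t; apply: tlin_ext => [||a b]; try by lin.
by rewrite tswapE tcontractlE tcontractrE.
Qed.

Lemma tcontractr_swap V W (e : {linear V -> k^o}) (t : V \ot W) :
  tcontractr e (tswap t) = tcontractl e t.
Proof. by rewrite -tcontractl_swap tswapK. Qed.

Lemma tswap_bij V W : bijective (@tswap k V W).
Proof. by exists tswap; apply: tswapK. Qed.

Variable X : coalgebra k.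

(** Coassociativity; iterated coproducts are written with the right-hand
nesting, the last name of each pair being expanded further. *)
Lemma coassoc U (x : X) (F : X -> X -> X -> U) : trilin F ->
  \sw_(a, b <- comul X x) \sw_(a1, a2 <- comul X a) F a1 a2 b =
  \sw_(a, b <- comul X x) \sw_(b1, b2 <- comul X b) F a b1 b2.
Proof.
move=> tF; pose h (t : X \ot (X \ot X)) := \sw_(a, t' <- t) tsum t' (F a).
have b2 a : bilin (F a) by lin.
have bh : bilin (fun a (t' : X \ot X) => tsum t' (F a)) by lin.
have lh : linear h by rewrite /h; lin.
transitivity (h (tassoc ((comul X \om idfun) (comul X x)))).
  rewrite -[in RHS](tsum_tens (comul X x)) !linear_tsum /h tsum_tsum //.
  apply: eq_tsum => a b; rewrite tmapE -[in RHS](tsum_tens (comul X a)).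
  rewrite tens_tsuml linear_tsum tsum_tsum //; apply: eq_tsum => a1 a2 /=.
  by rewrite tassocE !tsum_pure.
by rewrite comulA /h tsum_om.
Qed.

Lemma counitL U (x : X) (F : X -> U) : linear F ->
  \sw_(a, b <- comul X x) (counit X a : k) *: F b = F x.
Proof.
move=> lF; rewrite -[x in RHS]counitl -[comul X x in RHS]tsum_tens.
rewrite linear_tsum (lin_tsumE _ _ lF); apply: eq_tsum => a b.
by rewrite tcontractlE lin_scaleE.
Qed.

Lemma counitR U (x : X) (F : X -> U) : linear F ->
  \sw_(a, b <- comul X x) (counit X b : k) *: F a = F x.
Proof.
move=> lF; rewrite -[x in RHS]counitr -[comul X x in RHS]tsum_tens.
rewrite linear_tsum (lin_tsumE _ _ lF); apply: eq_tsum => a b.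
by rewrite tcontractrE lin_scaleE.
Qed.
End TsumRules.

Arguments coassoc {k X U} x F.
Arguments counitL {k X U} x F.
Arguments counitR {k X U} x F.

(** One step of a chain of equalities: the next member is read off the
right-hand side of the rule that t applies. *)
Tactic Notation "step" tactic3(t) := etransitivity; [t; lin|].
Tactic Notation "peel" ident(a) ident(b) := apply: eq_tsum => a b.

(** * Coalgebra morphisms and tensor products *)

Section Morphisms.
Variable k : fieldType.
Implicit Types (A B C Z : coalgebra k) (U : lmodType k).

Lemma tsum_tmid4 (A B C D U : lmodType k) (s : A \ot B) (t : C \ot D)
    (F : A \ot C -> B \ot D -> U) : bilin F ->
  tsum (tmid4 (s \ox t)) F =
  \sw_(a, b <- s) \sw_(c, d <- t) F (a \ox c) (b \ox d).
Proof.
move=> bF; rewrite -[in LHS](tsum_tens s) -[in LHS](tsum_tens t).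
rewrite tens_tsuml linear_tsum tsum_tsum //; peel a b.
rewrite tens_tsumr linear_tsum tsum_tsum //; peel c d.
by rewrite tmid4E tsum_pure.
Qed.

Lemma tsum_comul_tens A B U a b (F : A \ot B -> A \ot B -> U) : bilin F ->
  tsum (comul (tens A B) (a \ox b)) F =
  \sw_(a1, a2 <- comul A a) \sw_(b1, b2 <- comul B b) F (a1 \ox b1) (a2 \ox b2).
Proof. by move=> bF; rewrite /= tmapE tsum_tmid4. Qed.

Lemma coalg_morphism_comp A B Z (g : {linear B -> Z}) (f : {linear A -> B}) :
  coalg_morphism A B f -> coalg_morphism B Z g -> coalg_morphism A Z (g \o f).
Proof.
case=> df ef [dg eg]; split=> x /=; last by rewrite eg ef.
rewrite dg df; move: (comul A x); apply: tlin_ext => [||v w]; try by lin.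
by rewrite !tmapE.
Qed.

Section Projections.
Variables A B : coalgebra k.
Let p1 : {linear A \ot B -> A} := tcontractr (counit B).
Let p2 : {linear A \ot B -> B} := tcontractl (counit A).

Let p1E a b : p1 (a \ox b) = (counit B b : k) *: a.
Proof. exact: tcontractrE. Qed.
Let p2E a b : p2 (a \ox b) = (counit A a : k) *: b.
Proof. exact: tcontractlE. Qed.

Lemma proj1_morphism : coalg_morphism (tens A B) A p1.
Proof.
split; apply: tlin_ext => [||a b]; try (by lin); rewrite p1E.
- rewrite -[(p1 \om p1) _]tsum_tens tsum_om ?tsum_comul_tens; try by lin.
  rewrite linearZ_LR -[comul A a in LHS]tsum_tens linear_tsum.
  peel a1 a2.
  symmetry; step (peel b1 b2; rewrite !p1E tscalel; reflexivity).
  rewrite (counitL b (fun b => a1 \ox ((counit B b : k) *: a2))); last by lin.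
  by rewrite tscaler.
- by rewrite linearZ_LR /= tliftE [RHS]mulrC.
Qed.

Lemma proj2_morphism : coalg_morphism (tens A B) B p2.
Proof.
split; apply: tlin_ext => [||a b]; try (by lin); rewrite p2E.
- rewrite -[(p2 \om p2) _]tsum_tens tsum_om ?tsum_comul_tens; try by lin.
  rewrite linearZ_LR -[comul B b in LHS]tsum_tens linear_tsum tsum_exch.
  peel b1 b2.
  symmetry; step (peel a1 a2; rewrite !p2E tscalel; reflexivity).
  rewrite (counitL a (fun a => b1 \ox ((counit A a : k) *: b2))); last by lin.
  by rewrite tscaler.
- by rewrite linearZ_LR /= tliftE.
Qed.

Lemma projK t : (p1 \om p2) (comul (tens A B) t) = t.
Proof.
move: t; apply: tlin_ext => [||a b]; try by lin.
rewrite -[LHS]tsum_tens tsum_om ?tsum_comul_tens; try by lin.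
step (peel a1 a2; peel b1 b2; rewrite p1E p2E tscalel tscaler; reflexivity).
step (peel a1 a2; apply: (counitL b (fun b => (counit A a2 : k) *: (a1 \ox b)))).
by rewrite (counitR a (fun a => a \ox b : A \ot B)) //; lin.
Qed.

(** The two projections of a tensor product cocommute: they act on different
factors. *)
Lemma projK_swap t : (p1 \om p2) (tswap (comul (tens A B) t)) = t.
Proof.
move: t; apply: tlin_ext => [||a b]; try by lin.
rewrite -[LHS]tsum_tens tsum_om ?tsum_swap ?tsum_comul_tens; try by lin.
step (peel a1 a2; peel b1 b2; rewrite p1E p2E tscalel tscaler; reflexivity).
step (peel a1 a2; apply: (counitR b (fun b => (counit A a1 : k) *: (a2 \ox b)))).
by rewrite (counitL a (fun a => a \ox b : A \ot B)) //; lin.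
Qed.
End Projections.

Section Pair.
Variables Z A B : coalgebra k.
Implicit Types (f : {linear Z -> A}) (g : {linear Z -> B}).

Definition comul_pair f g : {linear Z -> A \ot B} := (f \om g) \o comul Z.

Definition cocommute f g : Prop :=
  forall z, (f \om g) (tswap (comul Z z)) = (f \om g) (comul Z z).

Lemma comul_pairE f g z :
  comul_pair f g z = \sw_(z1, z2 <- comul Z z) f z1 \ox g z2.
Proof.
rewrite -[LHS]/((f \om g) _) -[comul Z z in LHS]tsum_tens linear_tsum.
by peel z1 z2; rewrite tmapE.
Qed.

Lemma tsum_cocommute U f g (F : A -> B -> U) z : cocommute f g -> bilin F ->
  \sw_(z1, z2 <- comul Z z) F (f z2) (g z1) =
  \sw_(z1, z2 <- comul Z z) F (f z1) (g z2).
Proof.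
move=> cfg bF; have /(congr1 (fun t => tsum t F)) := cfg z.
by rewrite !tsum_om ?tsum_swap //; lin.
Qed.

(** Comparing the two sides amounts to exchanging the two middle legs of an
iterated coproduct, which is what cocommutation allows. *)
Lemma pair_morphism f g : coalg_morphism Z A f -> coalg_morphism Z B g ->
  cocommute f g -> coalg_morphism Z (tens A B) (comul_pair f g).
Proof.
move=> [df ef] [dg eg] cfg; split=> z; last first.
  rewrite comul_pairE linear_tsum -[in RHS](counitr z) -[comul Z z in RHS]tsum_tens.
  rewrite !linear_tsum; peel z1 z2.
  by rewrite tcontractrE linearZ_LR /= tliftE ef eg [RHS]mulrC.
rewrite comul_pairE linear_tsum -[RHS]tsum_tens tsum_om; last by lin.
pose T a b c d := (f a \ox g b) \ox (f c \ox g d).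
transitivity (\sw_(z1, z2 <- comul Z z) \sw_(p, q <- comul Z z1)
    \sw_(r, t <- comul Z z2) T p r q t).
  peel z1 z2; rewrite -[LHS]tsum_tens tsum_comul_tens; last by lin.
  by rewrite df tsum_om; last (by lin); peel p q; rewrite dg tsum_om; last by lin.
transitivity (\sw_(z1, z2 <- comul Z z) \sw_(p, q <- comul Z z1)
    \sw_(r, t <- comul Z z2) T p q r t); last first.
  peel z1 z2; rewrite comul_pairE tens_tsuml; peel p q.
  by rewrite comul_pairE tens_tsumr.
rewrite (coassoc z (fun a b c => \sw_(r, t <- comul Z c) T a r b t));
  last by rewrite /T; lin.
rewrite (coassoc z (fun a b c => \sw_(r, t <- comul Z c) T a b r t));
  last by rewrite /T; lin.
peel p z'; rewrite -(coassoc z' (fun b c d => T p c b d)); last by rewrite /T; lin.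
rewrite -(coassoc z' (fun b c d => T p b c d)); last by rewrite /T; lin.
peel w t; symmetry.
by apply: (tsum_cocommute (F := fun b c => (f p \ox c) \ox (b \ox g t))); lin.
Qed.

(** The projections are morphisms, they cocommute, and they recover a tensor from
its coproduct; all this is transported along h. *)
Lemma morphism_pair (h : {linear Z -> A \ot B}) : coalg_morphism Z (tens A B) h ->
  let f := tcontractr (counit B) \o h : {linear Z -> A} in
  let g := tcontractl (counit A) \o h : {linear Z -> B} in
  [/\ coalg_morphism Z A f, coalg_morphism Z B g, cocommute f g &
     h =1 comul_pair f g].
Proof.
move=> mh f g; have [dh eh] := mh.
pose p1 := tcontractr (counit B) : {linear A \ot B -> A}.
pose p2 := tcontractl (counit A) : {linear A \ot B -> B}.
have fgE t : (f \om g) t = (p1 \om p2) ((h \om h) t).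
  by move: t; apply: tlin_ext => [||u v]; try (by lin); rewrite !tmapE.
have hE z : h z = comul_pair f g z.
  by rewrite -[RHS]/((f \om g) (comul Z z)) fgE -dh projK.
split=> //.
- exact: (coalg_morphism_comp mh (proj1_morphism A B)).
- exact: (coalg_morphism_comp mh (proj2_morphism A B)).
- by move=> z; rewrite fgE tmap_tswap -dh projK_swap hE.
Qed.

Lemma pair_proj1 f g : (forall z, counit B (g z) = counit Z z) ->
  tcontractr (counit B) \o comul_pair f g =1 f.
Proof.
move=> eg z; rewrite -[LHS]/(tcontractr (counit B) (comul_pair f g z)).
rewrite comul_pairE linear_tsum.
rewrite -(counitR z f); last by lin.
by peel z1 z2; rewrite tcontractrE eg.
Qed.

Lemma pair_proj2 f g : (forall z, counit A (f z) = counit Z z) ->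
  tcontractl (counit A) \o comul_pair f g =1 g.
Proof.
move=> ef z; rewrite -[LHS]/(tcontractl (counit A) (comul_pair f g z)).
rewrite comul_pairE linear_tsum.
rewrite -(counitL z g); last by lin.
by peel z1 z2; rewrite tcontractlE ef.
Qed.

End Pair.

(** A morphism into a tensor product is the pair of its components. *)
Lemma morphism_ext Z A B (f g : {linear Z -> A \ot B}) :
  coalg_morphism Z (tens A B) f -> coalg_morphism Z (tens A B) g ->
  (forall z, tcontractr (counit B) (f z) = tcontractr (counit B) (g z)) ->
  (forall z, tcontractl (counit A) (f z) = tcontractl (counit A) (g z)) ->
  f =1 g.
Proof.
move=> /morphism_pair[_ _ _ fE] /morphism_pair[_ _ _ gE] h1 h2 z.
rewrite fE gE !comul_pairE; peel z1 z2; congr (_ \ox _); [exact: h1 | exact: h2].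
Qed.

Lemma idfun_morphism A : coalg_morphism A A idfun.
Proof.
split=> // x; rewrite -[RHS]tsum_tens tsum_om; last by lin.
by rewrite tsum_tens.
Qed.

Lemma tmap_morphism A A' B B' (f : {linear A -> A'}) (g : {linear B -> B'}) :
  coalg_morphism A A' f -> coalg_morphism B B' g ->
  coalg_morphism (tens A B) (tens A' B') (f \om g).
Proof.
move=> [df ef] [dg eg]; split; apply: tlin_ext => [||a b]; try (by lin).
  rewrite tmapE -[LHS]tsum_tens tsum_comul_tens; last by lin.
  rewrite df tsum_om; last by lin.
  rewrite -[RHS]tsum_tens tsum_om ?tsum_comul_tens; try by lin.
  peel a1 a2; rewrite dg tsum_om; last by lin.
  by peel b1 b2; rewrite !tmapE.
by rewrite tmapE !tliftE ef eg.
Qed.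

Lemma tassoc_morphism A B C :
  coalg_morphism (tens (tens A B) C) (tens A (tens B C)) tassoc.
Proof.
split; apply: tlin_ext => [||ab c]; try (by lin).
  move: ab; apply: tlin_ext => [||a b]; try (by lin).
  rewrite tassocE -[LHS]tsum_tens tsum_comul_tens; last by lin.
  rewrite -[RHS]tsum_tens tsum_om ?tsum_comul_tens; try by lin.
  peel a1 a2; rewrite tsum_comul_tens; last by lin.
  by peel b1 b2; peel c1 c2; rewrite !tassocE.
move: ab; apply: tlin_ext => [||a b]; try (by lin).
by rewrite tassocE !tliftE mulrA.
Qed.

Lemma tassocV_morphism A B C :
  coalg_morphism (tens A (tens B C)) (tens (tens A B) C) tassocV.
Proof.
split; apply: tlin_ext => [||a bc]; try (by lin).
  move: bc; apply: tlin_ext => [||b c]; try (by lin).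
  rewrite tassocVE -[LHS]tsum_tens tsum_comul_tens; last by lin.
  rewrite tsum_comul_tens; last by lin.
  rewrite -[RHS]tsum_tens tsum_om ?tsum_comul_tens; try by lin.
  peel a1 a2; rewrite tsum_comul_tens; last by lin.
  by peel b1 b2; peel c1 c2; rewrite !tassocVE.
move: bc; apply: tlin_ext => [||b c]; try (by lin).
by rewrite tassocVE !tliftE mulrA.
Qed.

Lemma tswap_morphism A B :
  coalg_morphism (tens A B) (tens B A) tswap.
Proof.
split; apply: tlin_ext => [||a b]; try (by lin).
  rewrite tswapE -[LHS]tsum_tens tsum_comul_tens; last by lin.
  rewrite -[RHS]tsum_tens tsum_om ?tsum_comul_tens; try by lin.
  by rewrite tsum_exch; peel a1 a2; peel b1 b2; rewrite !tswapE.
by rewrite tswapE !tliftE mulrC.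
Qed.

End Morphisms.

(** * Tensor products with the opposite coalgebra *)

Section Cop.
Variables (k : fieldType) (X : coalgebra k).

Lemma comul_tens_cop t : 
  comul (tens (cop X) X) t = tswap (comul (tens X (cop X)) t).
Proof.
move: t; apply: tlin_ext => [||x y]; try by lin.
rewrite /= !tmapE -[RHS]tsum_tens tsum_swap ?tsum_tmid4; try by lin.
rewrite -[LHS]tsum_tens tsum_tmid4 ?tsum_swap; try by lin.
by peel x1 x2; rewrite tsum_swap //; lin.
Qed.

Lemma comul_tens_copr t :
  comul (tens X (cop X)) t = tswap (comul (tens (cop X) X) t).
Proof.
rewrite comul_tens_cop; move: (comul _ _).
by apply: tlin_ext => [||u v]; try (by lin); rewrite !tswapE.
Qed.

Lemma comul_tens_copcop t :
  comul (tens (cop X) (cop X)) t = tswap (comul (tens X X) t).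
Proof.
move: t; apply: tlin_ext => [||x y]; try by lin.
rewrite -[LHS]tsum_tens tsum_comul_tens; last by lin.
rewrite -[RHS]tsum_tens tsum_swap ?tsum_comul_tens; try by lin.
rewrite tsum_swap; last by lin.
by peel x1 x2; rewrite tsum_swap //; lin.
Qed.

(** The counits below agree as functions, but they are induced by different
bilinearity proofs, so that the equalities do not hold by conversion. *)
Lemma tens_counit_copl t : tens_counit (cop X) X t = tens_counit X X t.
Proof.
by move: t; apply: tlin_ext => [||x y]; try (by lin); rewrite !tliftE.
Qed.

Lemma tens_counit_cop t : tens_counit (cop X) X t = tens_counit X (cop X) t.
Proof.
by move: t; apply: tlin_ext => [||x y]; try (by lin); rewrite !tliftE.
Qed.

Lemma tens_counit_copcop t : tens_counit (cop X) (cop X) t = tens_counit X X t.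
Proof.
by move: t; apply: tlin_ext => [||x y]; try (by lin); rewrite !tliftE.
Qed.

Lemma cop_morphism (s : {linear X \ot X -> X \ot X}) :
  coalg_morphism (tens X X) (tens X X) s ->
  coalg_morphism (tens (cop X) (cop X)) (tens (cop X) (cop X)) s.
Proof.
case=> ds es; split=> t.
  by rewrite !comul_tens_copcop ds tmap_tswap.
by rewrite [LHS]tens_counit_copcop [RHS]tens_counit_copcop; apply: es.
Qed.

End Cop.

(** * The operators Gmap *)

Section Gmap.
Variables (k : fieldType) (X : coalgebra k).
Implicit Types (m : {linear X \ot X -> X}) (x y : X) (U : lmodType k).

Lemma Gmap_tsum m x y :
  Gmap m (x \ox y) = \sw_(y1, y2 <- comul X y) m (x \ox y1) \ox y2.
Proof. exact: GmapE. Qed.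

Lemma tsum_Gmap U m x y (F : X -> X -> U) : bilin F ->
  tsum (Gmap m (x \ox y)) F = \sw_(y1, y2 <- comul X y) F (m (x \ox y1)) y2.
Proof.
move=> bF; rewrite Gmap_tsum.
by rewrite tsum_tsum //; apply: eq_tsum => *; rewrite tsum_pure.
Qed.

Lemma counit_Gmap m t : tcontractr (counit X) (Gmap m t) = m t.
Proof.
rewrite -[t]tsum_tens !linear_tsum; apply: eq_tsum => x y.
rewrite Gmap_tsum linear_tsum.
transitivity (\sw_(y1, y2 <- comul X y) counit X y2 *: m (x \ox y1)).
  by apply: eq_tsum => *; rewrite tcontractrE.
by rewrite (counitR y (fun y => m (x \ox y))) //; lin.
Qed.

Lemma Gmap_cop_tsum m (x y : X) :
  @Gmap k (cop X) m (x \ox y) = \sw_(y1, y2 <- comul X y) m (x \ox y2) \ox y1.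
Proof. exact: Gmap_copE. Qed.

Lemma Gmap_inj m m' : Gmap m =1 Gmap m' -> m = m'.
Proof.
move=> e; apply: linear_ext => t.
by rewrite -[LHS]counit_Gmap -[RHS]counit_Gmap e.
Qed.

(** A left convolution inverse of m induces a left inverse of Gmap m. *)
Lemma Gmap_cancel m m' : (forall t, m' (Gmap m t) = tcontractr (counit X) t) ->
  cancel (Gmap m) (Gmap m').
Proof.
move=> mK; apply: tlin_ext => [||x y]; try by lin.
rewrite Gmap_tsum linear_tsum.
step (peel y1 y'; rewrite Gmap_tsum; reflexivity).
rewrite -(coassoc y (fun a b c => m' (m (x \ox a) \ox b) \ox c)); last by lin.
rewrite -[RHS](counitL y (fun y => x \ox y)); last by lin.
peel y1 y2; rewrite -tens_tsuml -linear_tsum -Gmap_tsum mK tcontractrE.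
by rewrite tscalel.
Qed.

(** Gmap m commutes with the right coaction of X on X (x) X, hence so does its
inverse, which is therefore Gmap of its contraction with the counit. *)
Lemma Gmap_linv m : bijective (Gmap m) ->
  let m' := tcontractr (counit X) \o linv (Gmap m) : {linear _ -> _} in
  cancel (Gmap m) (Gmap m') /\ cancel (Gmap m') (Gmap m).
Proof.
move=> bm m'; have [mK Km] := linvP bm.
have m'K : cancel (Gmap m) (Gmap m').
  by apply: Gmap_cancel => t; rewrite /= -/(Gmap m) mK.
by split=> // t; rewrite -[t]Km m'K.
Qed.

Variables m m' : {linear X \ot X -> X}.
Hypothesis mK : cancel (Gmap m) (Gmap m').

(** The hypothesis makes m' a left convolution inverse of m in the second
variable, so that two adjacent legs of y acting by m and then by m' disappear; in
the first form a further leg follows. *)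
Lemma cancel_legs3 U x y (F : X -> X -> U) : bilin F ->
  \sw_(y1, y' <- comul X y) \sw_(y2, y3 <- comul X y')
    F (m' (m (x \ox y1) \ox y2)) y3 = F x y.
Proof.
move=> bF; rewrite -[RHS](tsum_pure x y bF) -[x \ox y in RHS]mK.
rewrite Gmap_tsum linear_tsum.
by rewrite tsum_tsum //; apply: eq_tsum => *; rewrite tsum_Gmap.
Qed.

Lemma cancel_legs U x y (F : X -> U) : linear F ->
  \sw_(y1, y2 <- comul X y) F (m' (m (x \ox y1) \ox y2)) =
  (counit X y : k) *: F x.
Proof.
move=> lF.
have bF : bilin (fun x y => (counit X y : k) *: F x) by lin.
rewrite -(cancel_legs3 x y bF); apply: eq_tsum => y1 y2.
by rewrite (counitR y2 (fun y => F (m' (m (x \ox y1) \ox y)))) //; lin.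
Qed.

(** An identity in x and y may be checked after the substitution
x := m'(x (x) y_1), y := y_2, because Gmap m' is surjective. *)
Lemma subst_Gmap U (f g : X -> X -> U) : bilin f -> bilin g ->
  (forall x y, \sw_(y1, y2 <- comul X y) f (m' (x \ox y1)) y2 =
               \sw_(y1, y2 <- comul X y) g (m' (x \ox y1)) y2) ->
  forall x y, f x y = g x y.
Proof.
move=> bf bg fg x y; rewrite -(tsum_pure x y bf) -(tsum_pure x y bg).
rewrite -(mK (_ \ox _)).
rewrite -[Gmap m _]tsum_tens linear_tsum !tsum_tsum //.
by apply: eq_tsum => a b; rewrite !tsum_Gmap.
Qed.

Lemma subst_Gmap_iff U (f g : X -> X -> U) : bilin f -> bilin g ->
  (forall x y, f x y = g x y) <->
  (forall x y, \sw_(y1, y2 <- comul X y) f (m' (x \ox y1)) y2 =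
               \sw_(y1, y2 <- comul X y) g (m' (x \ox y1)) y2).
Proof.
move=> bf bg; split=> [fg x y|]; last exact: subst_Gmap.
by peel y1 y2.
Qed.

End Gmap.
Arguments cancel_legs3 {k X m m'} mK {U} x y F.
Arguments cancel_legs {k X m m'} mK {U} x y F.
Arguments subst_Gmap {k X m m'} mK {U} f g.
Arguments subst_Gmap_iff {k X m m'} mK {U} f g.

(** * Crossings *)

(** When d is a comultiplication on the carrier of X, this says that
x (x) y |-> L(x_1 (x) y_1) (x) R(x_2 (x) y_2) is a coalgebra morphism
X' (x) X -> X (x) X', where X' is X with comultiplication d.  The cases of
interest are d = Delta for solutions and d = tau Delta for q-magma coalgebras. *)
Definition crossing (k : fieldType) (X : coalgebra k)
    (d : {linear X -> X \ot X}) (R L : {linear X \ot X -> X}) : Prop :=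
  [/\ forall x y, counit X (R (x \ox y)) = counit X x * counit X y :> k,
      forall x y, counit X (L (x \ox y)) = counit X x * counit X y :> k,
      forall x y, d (R (x \ox y)) =
        \sw_(x1, x2 <- d x) \sw_(y1, y2 <- comul X y)
           R (x1 \ox y1) \ox R (x2 \ox y2),
      forall x y, comul X (L (x \ox y)) =
        \sw_(x1, x2 <- d x) \sw_(y1, y2 <- comul X y)
           L (x1 \ox y1) \ox L (x2 \ox y2)
    & forall x y,
        \sw_(x1, x2 <- d x) \sw_(y1, y2 <- comul X y)
           L (x1 \ox y1) \ox R (x2 \ox y2) =
        \sw_(x1, x2 <- d x) \sw_(y1, y2 <- comul X y)
           L (x2 \ox y2) \ox R (x1 \ox y1)].

Section CrossingRules.
Variables (k : fieldType) (X : coalgebra k).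
Variables (d : {linear X -> X \ot X}) (R L : {linear X \ot X -> X}).
Hypothesis cRL : crossing d R L.
Implicit Types (x y : X) (U : lmodType k).

Lemma tsum_dR U x y (F : X -> X -> U) : bilin F ->
  tsum (d (R (x \ox y))) F =
  \sw_(x1, x2 <- d x) \sw_(y1, y2 <- comul X y)
    F (R (x1 \ox y1)) (R (x2 \ox y2)).
Proof.
case: cRL => _ _ -> _ _ bF; rewrite tsum_tsum //; apply: eq_tsum => x1 x2.
by rewrite tsum_tsum //; apply: eq_tsum => y1 y2; rewrite tsum_pure.
Qed.

Lemma tsum_comulL U x y (F : X -> X -> U) : bilin F ->
  tsum (comul X (L (x \ox y))) F =
  \sw_(x1, x2 <- d x) \sw_(y1, y2 <- comul X y)
    F (L (x1 \ox y1)) (L (x2 \ox y2)).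
Proof.
case: cRL => _ _ _ -> _ bF; rewrite tsum_tsum //; apply: eq_tsum => x1 x2.
by rewrite tsum_tsum //; apply: eq_tsum => y1 y2; rewrite tsum_pure.
Qed.

Lemma tsum_LR_swap U x y (F : X -> X -> U) : bilin F ->
  \sw_(x1, x2 <- d x) \sw_(y1, y2 <- comul X y)
    F (L (x1 \ox y1)) (R (x2 \ox y2)) =
  \sw_(x1, x2 <- d x) \sw_(y1, y2 <- comul X y)
    F (L (x2 \ox y2)) (R (x1 \ox y1)).
Proof.
case: cRL => _ _ _ _ /(_ x y)/(congr1 (fun t => tsum t F)) + bF.
rewrite !tsum_tsum // => E.
transitivity (\sw_(a, b <- d x)
  tsum (\sw_(y1, y2 <- comul X y) L (a \ox y1) \ox R (b \ox y2)) F).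
  apply: eq_tsum => x1 x2.
  by rewrite tsum_tsum //; apply: eq_tsum => y1 y2; rewrite tsum_pure.
rewrite E; apply: eq_tsum => x1 x2.
by rewrite tsum_tsum //; apply: eq_tsum => y1 y2; rewrite tsum_pure.
Qed.

Lemma tsum_dR_leg U x y (F : X -> X -> X -> U) : trilin F ->
  \sw_(y1, y' <- comul X y) \sw_(u1, u2 <- d (R (x \ox y1))) F u1 u2 y' =
  \sw_(x1, x2 <- d x) \sw_(y1, y' <- comul X y) \sw_(y2, y3 <- comul X y')
    F (R (x1 \ox y1)) (R (x2 \ox y2)) y3.
Proof.
move=> tF.
step (peel y1 y'; apply: (tsum_dR x y1 (F := fun u v => F u v y'))).
rewrite tsum_exch; apply: eq_tsum => x1 x2.
by apply: (coassoc y (fun a b c => F (R (x1 \ox a)) (R (x2 \ox b)) c)); lin.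
Qed.

Lemma tsum_LR_swap_leg U x y (F : X -> X -> X -> U) : trilin F ->
  \sw_(x1, x2 <- d x) \sw_(y1, y' <- comul X y) \sw_(y2, y3 <- comul X y')
    F (L (x2 \ox y2)) (R (x1 \ox y1)) y3 =
  \sw_(x1, x2 <- d x) \sw_(y1, y' <- comul X y) \sw_(y2, y3 <- comul X y')
    F (L (x1 \ox y1)) (R (x2 \ox y2)) y3.
Proof.
move=> tF.
step (peel x1 x2; symmetry;
  apply: (coassoc y (fun a b c => F (L (x2 \ox b)) (R (x1 \ox a)) c))).
symmetry.
step (peel x1 x2; symmetry;
  apply: (coassoc y (fun a b c => F (L (x1 \ox a)) (R (x2 \ox b)) c))).
rewrite tsum_exch [RHS]tsum_exch; peel y' y3.
by apply: (@tsum_LR_swap _ x y' (fun u v => F u v y3)); lin.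
Qed.

End CrossingRules.
Arguments tsum_LR_swap_leg {k X d R L} cRL {U} x y F.
Arguments tsum_dR_leg {k X d R L} cRL {U} x y F.
Arguments tsum_dR {k X d R L} cRL {U} x y F.
Arguments tsum_comulL {k X d R L} cRL {U} x y F.

(** Both sides of each identity for D and L' = L o Gmap D are bilinear in x and y,
hence may be compared after the substitution x := x^(y_1), y := y_2.  The legs of
y then meet in the order x_1^(y_1), x_2^(y_2), y_3, y_4, and cancelling y_2 with
y_3 before y_1 with y_4 is what reverses the coproduct of x. *)
Lemma crossing_inv (k : fieldType) (X : coalgebra k)
    (d : {linear X -> X \ot X}) (R L D : {linear X \ot X -> X}) :
  cancel (Gmap R) (Gmap D) -> cancel (Gmap D) (Gmap R) ->
  crossing d R L -> crossing (tswap \o d) D (L \o Gmap D).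
Proof.
move=> RK DK c; have [eR eL _ dL _] := c.
have LE x y : (L \o Gmap D : {linear _ -> _}) (Gmap R (x \ox y)) = L (x \ox y).
  exact: congr1 (RK _).
move: (L \o Gmap D : {linear _ -> _}) LE => L' LE.
have L'E (U : lmodType k) x y (F : X -> X -> U) : bilin F ->
    \sw_(y1, y' <- comul X y) \sw_(y2, y3 <- comul X y')
      F (L' (R (x \ox y1) \ox y2)) y3 =
    \sw_(y1, y2 <- comul X y) F (L (x \ox y1)) y2.
  move=> bF.
  rewrite -(coassoc y (fun a b c => F (L' (R (x \ox a) \ox b)) c)); last by lin.
  apply: eq_tsum => y1 y2; rewrite -LE Gmap_tsum linear_tsum.
  by rewrite (lin_tsumE _ _ (f := F^~ y2)) //; lin.
have tswapd (U : lmodType k) x (F : X -> X -> U) : bilin F ->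
    tsum (tswap (d x)) F = \sw_(x1, x2 <- d x) F x2 x1 by exact: tsum_swap.
pose g x y : k^o := (counit X x : k) *: counit X y.
have gE x y : \sw_(y1, y2 <- comul X y) g (R (x \ox y1)) y2 =
    counit X x * counit X y :> k.
  rewrite [LHS](_ : _ = \sw_(y1, y2 <- comul X y) (counit X y1 : k) *: g x y2).
    by rewrite (counitL y (g x)) // /g; lin.
  by apply: eq_tsum => y1 y2; rewrite /g eR scalerA [counit X x * _]mulrC.
split=> [x y|x y|x y|x y|x y].
- pose f x y : k^o := counit X (D (x \ox y)).
  apply: (subst_Gmap DK (U := k^o) f g) => {x y}[||x y];
    [by rewrite /f; lin|by rewrite /g; lin|].
  rewrite gE /f (cancel_legs RK x y (counit X)); last by lin.
  exact: (@mulrC k).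
- pose f x y : k^o := counit X (L' (x \ox y)).
  apply: (subst_Gmap DK (U := k^o) f g) => {x y}[||x y];
    [by rewrite /f; lin|by rewrite /g; lin|].
  by rewrite gE -eL -LE Gmap_tsum !linear_tsum.
- rewrite /= tsum_swap; last by lin.
  move: x y; apply: (subst_Gmap DK) => [||x y]; [by lin|by lin|].
  rewrite (cancel_legs RK x y (fun x => tswap (d x))); last by lin.
  symmetry; step (apply: (tsum_dR_leg c x y (fun u1 u2 y' =>
    \sw_(y3, y4 <- comul X y') D (u2 \ox y3) \ox D (u1 \ox y4)))).
  step (peel x1 x2; peel y1 y';
    apply: (cancel_legs3 RK _ _ (fun a b => a \ox D (R (x1 \ox y1) \ox b)))).
  step (peel x1 x2; apply: (cancel_legs RK _ _ (fun a => x2 \ox a))).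
  rewrite -[d x in RHS]tsum_tens linear_tsum [RHS]linear_tsum.
  by peel x1 x2; rewrite tswapE.
- rewrite tsum_swap; last by lin.
  move: x y; apply: (subst_Gmap DK) => [||x y]; [by lin|by lin|].
  transitivity (comul X (L (x \ox y))).
    by rewrite -LE Gmap_tsum !linear_tsum.
  symmetry; step (apply: (tsum_dR_leg c x y (fun u1 u2 y' =>
    \sw_(y3, y4 <- comul X y') L' (u2 \ox y3) \ox L' (u1 \ox y4)))).
  step (peel x1 x2; peel y1 y';
    apply: (L'E _ _ _ (fun a b => a \ox L' (R (x1 \ox y1) \ox b)))).
  step (apply: (tsum_LR_swap_leg c x y (fun u v y3 => u \ox L' (v \ox y3)))).
  rewrite dL.
  peel x1 x2; peel y1 y2.
  by rewrite -[L (x2 \ox _)]LE Gmap_tsum linear_tsum tens_tsumr.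
- rewrite /= !tswapd; [|by lin|by lin].
  move: x y; apply: (subst_Gmap DK) => [||x y]; [by lin|by lin|].
  step (apply: (tsum_dR_leg c x y (fun u1 u2 y' =>
    \sw_(y3, y4 <- comul X y') L' (u2 \ox y3) \ox D (u1 \ox y4)))).
  step (peel x1 x2; peel y1 y';
    apply: (L'E _ _ _ (fun a b => a \ox D (R (x1 \ox y1) \ox b)))).
  step (apply: (tsum_LR_swap_leg c x y (fun u v y3 => u \ox D (v \ox y3)))).
  symmetry.
  step (apply: (tsum_dR_leg c x y (fun u1 u2 y' =>
    \sw_(y3, y4 <- comul X y') L' (u1 \ox y4) \ox D (u2 \ox y3)))).
  step (peel x1 x2; peel y1 y';
    apply: (cancel_legs3 RK _ _
      (fun a b => L' (R (x1 \ox y1) \ox b) \ox a))).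
  peel x1 x2; rewrite -tens_tsuml -linear_tsum -Gmap_tsum LE.
  symmetry; step (peel y1 y';
    apply: (cancel_legs RK x2 y' (fun a => L (x1 \ox y1) \ox a))).
  by rewrite (counitR y (fun y => L (x1 \ox y) \ox x2)) //; lin.
Qed.

Section CrossingMorphism.
Variables (k : fieldType) (X : coalgebra k).
Implicit Types (d : {linear X -> X \ot X}) (R L : {linear X \ot X -> X}).

(** W is the comultiplication of tens X X when d = Delta, and that of
tens (cop X) X when d = tau Delta, in both cases by conversion. *)
Lemma crossingP d R L (W : {linear X \ot X -> (X \ot X) \ot (X \ot X)} :=
    tmid4 \o (d \om comul X)) :
  crossing d R L <->
  [/\ forall t, counit X (R t) = tens_counit X X t,
      forall t, counit X (L t) = tens_counit X X t,
      forall t, d (R t) = (R \om R) (W t),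
      forall t, comul X (L t) = (L \om L) (W t)
    & forall t, (L \om R) (tswap (W t)) = (L \om R) (W t)].
Proof.
have WE (f g : {linear X \ot X -> X}) x y : (f \om g) (W (x \ox y)) =
    \sw_(x1, x2 <- d x) \sw_(y1, y2 <- comul X y)
      f (x1 \ox y1) \ox g (x2 \ox y2).
  rewrite -[LHS]tsum_tens tsum_om; last by lin.
  by rewrite [W]lock /= -lock /W /= tmapE tsum_tmid4 //; lin.
have WsE (f g : {linear X \ot X -> X}) x y : (f \om g) (tswap (W (x \ox y))) =
    \sw_(x1, x2 <- d x) \sw_(y1, y2 <- comul X y)
      f (x2 \ox y2) \ox g (x1 \ox y1).
  rewrite -[LHS]tsum_tens tsum_om ?tsum_swap; try by lin.
  by rewrite [W]lock /= -lock /W /= tmapE tsum_tmid4 //; lin.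
split=> -[h1 h2 h3 h4 h5]; split.
- by apply: tlin_ext => [||x y]; try (by lin); rewrite h1 tliftE.
- by apply: tlin_ext => [||x y]; try (by lin); rewrite h2 tliftE.
- by apply: tlin_ext => [||x y]; try (by lin); rewrite h3 WE.
- by apply: tlin_ext => [||x y]; try (by lin); rewrite h4 WE.
- by apply: tlin_ext => [||x y]; try (by lin); rewrite WE WsE h5.
- by move=> x y; rewrite h1 tliftE.
- by move=> x y; rewrite h2 tliftE.
- by move=> x y; rewrite h3 WE.
- by move=> x y; rewrite h4 WE.
- by move=> x y; rewrite -WE -WsE h5.
Qed.

Lemma crossing_of_morphism (s : {linear X \ot X -> X \ot X}) :
  coalg_morphism (tens X X) (tens X X) s ->
  crossing (comul X) (ract s) (lact s).
Proof.
case/morphism_pair=> -[dL eL] [dR eR] c _; apply/crossingP.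
split; [exact: eR | exact: eL | exact: dR | exact: dL | exact: c].
Qed.

Lemma morphism_of_crossing R L : crossing (comul X) R L ->
  coalg_morphism (tens X X) (tens X X) (@comul_pair _ (tens X X) X X L R).
Proof.
by case/crossingP=> eR eL dR dL c; apply: pair_morphism.
Qed.

Lemma qmap_pair (q : qpair X) :
  qmap q =1 @comul_pair _ (tens (cop X) X) X (cop X)
             (qcolon q \o tswap) (qdot q).
Proof.
apply: tlin_ext => [||x y]; try by lin.
rewrite qmapE comul_pairE tsum_comul_tens; last by lin.
rewrite -/(tsum _ (fun a b => \sum_(v <- _) _ (v.1 \ox b) \ox _ (a \ox v.2))).
rewrite [RHS]tsum_swap; last by lin.
by peel a b; apply: eq_bigr => v _; rewrite /= tswapE.
Qed.

(** A morphism tens X (cop X) -> tens (cop X) X is the same as a morphism between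
the opposite coalgebras tens (cop X) X -> tens X (cop X), where qmap q is the
pair of its two operations. *)
Lemma qmagma_crossing (q : qpair X) :
  qmagma_coalgebra q <->
  crossing (tswap \o comul X) (qdot q) (qcolon q \o tswap).
Proof.
set C : {linear X \ot X -> X} := qcolon q \o tswap.
have counitE (f : {linear X \ot X -> X}) :
    (forall x y, counit X (f (x \ox y)) = counit X x * counit X y :> k) ->
    forall t, counit X (f t) = tens_counit (cop X) X t.
  by move=> ef; apply: tlin_ext => [||x y]; try (by lin); rewrite ef tliftE.
split=> [[eD eC [dq eq]] | c].
  have eC' x y : counit X (C (x \ox y)) = counit X x * counit X y :> k.
    by rewrite /= tswapE eC mulrC.
  have : coalg_morphism (tens (cop X) X) (tens X (cop X)) (qmap q).
    split=> t; first by rewrite comul_tens_cop comul_tens_copr dq tmap_tswap.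
    by rewrite [RHS]tens_counit_cop -[RHS]eq [RHS]tens_counit_cop.
  case/morphism_pair.
  have -> : tcontractr (counit (cop X)) \o qmap q = C :> {linear X \ot X -> X}.
    apply: linear_ext => t; rewrite -[LHS]/(tcontractr _ (qmap q t)) qmap_pair.
    exact: (@pair_proj1 _ (tens (cop X) X) X (cop X) C _ (counitE _ eD)).
  have -> : tcontractl (counit X) \o qmap q = qdot q :> {linear X \ot X -> X}.
    apply: linear_ext => t; rewrite -[LHS]/(tcontractl _ (qmap q t)) qmap_pair.
    exact: (@pair_proj2 _ (tens (cop X) X) X (cop X) C _ (counitE _ eC')).
  move=> [dC' _] [dD _] cc _; apply/crossingP.
  split; [| |exact: dD|exact: dC'|exact: cc].
  - by move=> t; rewrite -tens_counit_copl; exact: counitE.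
  - by move=> t; rewrite -tens_counit_copl; exact: counitE.
have [eD eC _ _ _] := c.
split=> //; first by move=> x y; have := eC y x; rewrite /= tswapE mulrC.
case/crossingP: c => eD' eC' dD dC cc.
have [dq eq] : coalg_morphism (tens (cop X) X) (tens X (cop X)) (qmap q).
  have -> : qmap q = @comul_pair _ (tens (cop X) X) X (cop X) C (qdot q).
    exact: linear_ext (qmap_pair q).
  apply: pair_morphism => //; split=> // t; rewrite [RHS]tens_counit_copl.
  - exact: eC'.
  - exact: eD'.
split=> t; first by rewrite comul_tens_copr comul_tens_cop dq tmap_tswap.
by rewrite -[RHS]tens_counit_cop -[RHS]eq -[RHS]tens_counit_cop.
Qed.

End CrossingMorphism.

(** * Duality between solutions and q-magma coalgebras *)

Section Dual.
Variables (k : fieldType) (X : coalgebra k).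
Implicit Types (s : {linear X \ot X -> X \ot X}) (q : qpair X).

(** The last condition is ^x y = y_2 : x^(y_1).  Stating the correspondence as a
relation makes it usable from either side, without unfolding the inverses in
qpair_of and qract. *)
Definition dual s q : Prop :=
  [/\ coalg_morphism (tens X X) (tens X X) s,
      cancel (Gmap (ract s)) (Gmap (qdot q)),
      cancel (Gmap (qdot q)) (Gmap (ract s))
    & forall t, qcolon q (tswap (Gmap (ract s) t)) = lact s t].

Lemma dual_of_left_nondeg s : left_nondeg s -> dual s (qpair_of s).
Proof.
case=> ms /Gmap_linv[RK DK]; split=> // t.
by rewrite -[LHS]/(lact s (Gmap (sdot s) (tswap (tswap (Gmap (ract s) t)))))
  tswapK RK.
Qed.

Lemma dual_left_nondeg s q : dual s q -> left_nondeg s.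
Proof. by case=> ms RK DK _; split=> //; exists (Gmap (qdot q)). Qed.

Lemma dual_qpair_of s q : dual s q -> qpair_of s = q.
Proof.
case=> ms RK DK CE.
have [RK' DK'] := Gmap_linv (Bijective RK DK).
have eD : sdot s = qdot q.
  by apply: Gmap_inj => t; rewrite -[LHS](congr1 _ (DK t)) RK'.
have eC : scolon s = qcolon q.
  apply: linear_ext => t.
  by rewrite -[LHS]/(lact s (Gmap (sdot s) (tswap t))) -CE eD DK tswapK.
by rewrite /qpair_of eD eC; case: (q).
Qed.

Lemma dual_inj s s' q : dual s q -> dual s' q -> s = s'.
Proof.
move=> [ms RK DK CE] [ms' RK' DK' CE'].
have eR : ract s = ract s'.
  by apply: Gmap_inj => t; rewrite -[LHS]DK' RK.
have eL : lact s = lact s' by apply: linear_ext => t; rewrite -CE -CE' eR.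
apply: linear_ext => t.
case/morphism_pair: ms => _ _ _ ->; case/morphism_pair: ms' => _ _ _ ->.
by congr (comul_pair _ _ _).
Qed.

Lemma dual_qmagma s q : dual s q -> qmagma_coalgebra q /\ qleft_regular q.
Proof.
case=> ms RK DK CE; split; last by exists (Gmap (ract s)).
apply/qmagma_crossing.
have := crossing_inv RK DK (crossing_of_morphism ms).
congr crossing; apply: linear_ext => t.
by rewrite -[LHS]/(lact s (Gmap (qdot q) t)) -CE DK.
Qed.

Lemma dual_of_qmagma q :
  qmagma_coalgebra q -> qleft_regular q -> exists s, dual s q.
Proof.
move=> /qmagma_crossing cq /Gmap_linv [DK RK].
rewrite -/(qract q) in DK RK.
have := crossing_inv DK RK cq.
have -> : tswap \o (tswap \o comul X) = comul X :> {linear _ -> _}.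
  by apply: linear_ext => x; rewrite /= tswapK.
rewrite -/(qlact q) => cs.
have [eR eL _ _ _] := (crossingP _ _ _).1 cs.
pose s : {linear X \ot X -> X \ot X} :=
  @comul_pair _ (tens X X) X X (qlact q) (qract q).
have es : ract s = qract q.
  by apply: linear_ext; apply: (@pair_proj2 _ (tens X X) X X).
have ls : lact s = qlact q.
  by apply: linear_ext; apply: (@pair_proj1 _ (tens X X) X X).
exists s; rewrite /dual es ls; split=> //.
exact: morphism_of_crossing.
Qed.

End Dual.

(** * Sweedler rules for a dual pair *)

Section DualRules.
Variables (k : fieldType) (X : coalgebra k).
Variables (s : {linear X \ot X -> X \ot X}) (q : qpair X).
Hypothesis sq : dual s q.
Local Notation R := (ract s).
Local Notation L := (lact s).
Local Notation D := (qdot q).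
Local Notation C := (qcolon q).
Implicit Types (U : lmodType k) (w x y z : X).

Lemma dual_crossing : crossing (comul X) R L.
Proof. by case: sq => /crossing_of_morphism. Qed.
Lemma dual_RK : cancel (Gmap R) (Gmap D). Proof. by case: sq. Qed.
Lemma dual_DK : cancel (Gmap D) (Gmap R). Proof. by case: sq. Qed.

Lemma colon_act U x y (F : X -> U) : linear F ->
  \sw_(y1, y2 <- comul X y) F (C (y2 \ox R (x \ox y1))) = F (L (x \ox y)).
Proof.
move=> lF; case: sq => _ _ _ CE.
rewrite -CE Gmap_tsum !linear_tsum (lin_tsumE _ _ lF).
by peel a b; rewrite tswapE.
Qed.

Lemma act_dot U x y (F : X -> U) : linear F ->
  \sw_(y1, y2 <- comul X y) F (L (D (x \ox y1) \ox y2)) = F (C (y \ox x)).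
Proof.
move=> lF; have CE : C (tswap (x \ox y)) = L (Gmap D (x \ox y)).
  by case: sq => _ RK DK CE; rewrite -CE DK.
by rewrite -tswapE CE Gmap_tsum !linear_tsum (lin_tsumE _ _ lF).
Qed.

Lemma tsum_sol_tens U t (F : X -> X -> U) : bilin F ->
  tsum (s t) F = \sw_(t1, t2 <- comul (tens X X) t) F (L t1) (R t2).
Proof.
move=> bF; case: sq => /morphism_pair[_ _ _ ->] _ _ _.
by rewrite comul_pairE tsum_tsum //; peel t1 t2; rewrite tsum_pure.
Qed.

Lemma tsum_sol_tens_swap U t (F : X -> X -> U) : bilin F ->
  tsum (s t) F = \sw_(t1, t2 <- comul (tens X X) t) F (L t2) (R t1).
Proof.
move=> bF; have [/morphism_pair[_ _ cc _] _ _ _] := sq.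
by rewrite tsum_sol_tens // (@tsum_cocommute _ (tens X X) X X _ _ _ F t cc bF).
Qed.

Lemma tsum_sol U x y (F : X -> X -> U) : bilin F ->
  tsum (s (x \ox y)) F =
  \sw_(x1, x2 <- comul X x) \sw_(y1, y2 <- comul X y)
    F (L (x1 \ox y1)) (R (x2 \ox y2)).
Proof. by move=> bF; rewrite tsum_sol_tens // tsum_comul_tens //; lin. Qed.

(** The three rules below give the coproducts of the factors of u (x) v = s(t): for
instance u (x) v_1 (x) v_2 is s(t_1) followed by the second component of
s(t_2). *)
Lemma sol_comulr U x y (F : X -> X -> X -> U) : trilin F ->
  \sw_(x1, x2 <- comul X x) \sw_(y1, y2 <- comul X y)
    \sw_(u, v <- s (x1 \ox y1)) F u v (R (x2 \ox y2)) =
  \sw_(u, v <- s (x \ox y)) \sw_(v1, v2 <- comul X v) F u v1 v2.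
Proof.
move=> tF; have [/morphism_pair[_ [dR _] _ _] _ _ _] := sq.
rewrite -(tsum_comul_tens x y
  (F := fun t1 t2 => \sw_(u, v <- s t1) F u v (R t2))); last by lin.
rewrite tsum_sol_tens; last by lin.
step (peel t1 t2; apply: tsum_sol_tens).
step (apply: (coassoc (X := tens X X) _
  (fun t1 t2 t3 => F (L t1) (R t2) (R t3)))).
by peel t1 t2; rewrite dR tsum_om; lin.
Qed.

Lemma sol_comulm U x y (F : X -> X -> X -> U) : trilin F ->
  \sw_(x1, x2 <- comul X x) \sw_(y1, y2 <- comul X y)
    \sw_(u, v <- s (x2 \ox y2)) F u (R (x1 \ox y1)) v =
  \sw_(u, v <- s (x \ox y)) \sw_(v1, v2 <- comul X v) F u v1 v2.
Proof.
move=> tF; have [/morphism_pair[_ [dR _] _ _] _ _ _] := sq.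
rewrite -(tsum_comul_tens x y
  (F := fun t1 t2 => \sw_(u, v <- s t2) F u (R t1) v)); last by lin.
rewrite tsum_sol_tens_swap; last by lin.
step (peel t1 t2; apply: tsum_sol_tens_swap).
symmetry; step (peel t1 t2; rewrite dR tsum_om; [reflexivity|lin]).
by apply: (coassoc (X := tens X X) _
  (fun t1 t2 t3 => F (L t3) (R t1) (R t2))); lin.
Qed.

Lemma sol_comull U x y (F : X -> X -> X -> U) : trilin F ->
  \sw_(x1, x2 <- comul X x) \sw_(y1, y2 <- comul X y)
    \sw_(u, v <- s (x1 \ox y1)) F u (L (x2 \ox y2)) v =
  \sw_(u, v <- s (x \ox y)) \sw_(u1, u2 <- comul X u) F u1 u2 v.
Proof.
move=> tF; have [/morphism_pair[[dL _] _ _ _] _ _ _] := sq.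
rewrite -(tsum_comul_tens x y
  (F := fun t1 t2 => \sw_(u, v <- s t1) F u (L t2) v)); last by lin.
rewrite tsum_sol_tens_swap; last by lin.
step (peel t1 t2; apply: tsum_sol_tens_swap).
step (apply: (coassoc (X := tens X X) _
  (fun t1 t2 t3 => F (L t2) (L t3) (R t1)))).
by peel t1 t2; rewrite dL tsum_om; lin.
Qed.

(** The relation y : x = ^(x . y_1) y_2 in the form s = K o tau o G, with
K : x (x) y |-> x : y_2 (x) y_1. *)
Lemma sol_factor t : s t = @Gmap k (cop X) C (tswap (Gmap R t)).
Proof.
move: t; apply: tlin_ext => [||x y]; try by lin.
rewrite -[LHS]tsum_tens tsum_sol_tens_swap ?tsum_comul_tens; try by lin.
rewrite Gmap_tsum !linear_tsum; symmetry.
step (peel y1 y2; rewrite tswapE Gmap_cop_tsum; reflexivity).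
step (apply: (tsum_dR_leg dual_crossing x y
  (fun u1 u2 y' => C (y' \ox u2) \ox u1))).
peel x1 x2; peel y1 y'.
by apply: (@colon_act _ x2 y' (fun u => u \ox R (x1 \ox y1))); lin.
Qed.

Lemma tsum_sol_dot U w z (F : X -> X -> U) : bilin F ->
  tsum (s (Gmap D (w \ox z))) F =
  \sw_(w1, w2 <- comul X w) F (C (z \ox w2)) w1.
Proof.
move=> bF; rewrite sol_factor dual_DK tswapE Gmap_cop_tsum.
by rewrite tsum_tsum //; peel a b; rewrite tsum_pure.
Qed.

Lemma tsum_comul_dot U x y (F : X -> X -> U) : bilin F ->
  tsum (comul X (D (x \ox y))) F =
  \sw_(x1, x2 <- comul X x) \sw_(y1, y2 <- comul X y)
    F (D (x1 \ox y2)) (D (x2 \ox y1)).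
Proof.
move=> bF; have [/qmagma_crossing cq _] := dual_qmagma sq.
have -> : comul X (D (x \ox y)) = tswap ((tswap \o comul X) (D (x \ox y))).
  by rewrite /= tswapK.
rewrite tsum_swap // (tsum_dR cq x y (fun a b => F b a)); last by lin.
by rewrite tsum_swap //; lin.
Qed.

Lemma tsum_comul_colon U x y (F : X -> X -> U) : bilin F ->
  tsum (comul X (C (x \ox y))) F =
  \sw_(y1, y2 <- comul X y) \sw_(x1, x2 <- comul X x)
    F (C (x1 \ox y2)) (C (x2 \ox y1)).
Proof.
move=> bF; have [/qmagma_crossing cq _] := dual_qmagma sq.
have -> : C (x \ox y) = (C \o tswap) (y \ox x) by rewrite /= tswapE.
rewrite (tsum_comulL cq) // tsum_swap; last by lin.
by peel y1 y2; peel x1 x2; rewrite /= !tswapE.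
Qed.

Lemma counit_colon x y : counit X (C (x \ox y)) = counit X x * counit X y :> k.
Proof. by have [[_ ->]] := dual_qmagma sq. Qed.

Lemma sol_colon U y x (F : X -> X -> U) : bilin F ->
  \sw_(x', x3 <- comul X x) \sw_(u, v <- s (y \ox x')) F u (C (x3 \ox v)) =
  \sw_(w1, w2 <- comul X (L (y \ox x))) F w1 w2.
Proof.
move=> bF; rewrite (tsum_comulL dual_crossing) //.
step (peel x' x3; apply: (tsum_sol)).
rewrite tsum_exch; peel y1 y2.
rewrite (coassoc x (fun p t r =>
  F (L (y1 \ox p)) (C (r \ox R (y2 \ox t))))); last by lin.
peel x1 x'.
by apply: (@colon_act _ y2 x' (fun w => F (L (y1 \ox x1)) w)); lin.
Qed.

End DualRules.
Arguments colon_act {k X s q} sq {U} x y F.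
Arguments act_dot {k X s q} sq {U} x y F.
Arguments tsum_sol_dot {k X s q} sq {U} w z F.
Arguments tsum_comul_dot {k X s q} sq {U} x y F.
Arguments tsum_comul_colon {k X s q} sq {U} x y F.

(** * The braid equation and the q-cycle identities *)

(** Uniqueness of inverses in the convolution monoid of maps V (x) Z -> V: the
pullback of g along sg is inverse to that of f, which is f. *)
Lemma conv_inv_invariant (k : fieldType) (Z : coalgebra k) (V : lmodType k)
    (f g : V -> Z -> V) (sg : {linear Z -> Z}) :
  bilin f -> bilin g -> coalg_morphism Z Z sg ->
  (forall a z, \sw_(z1, z2 <- comul Z z) g (f a z1) z2 =
                 (counit Z z : k) *: a) ->
  (forall a z, \sw_(z1, z2 <- comul Z z) f (g a z1) z2 =
                 (counit Z z : k) *: a) ->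
  (forall a z, f a (sg z) = f a z) -> forall a z, g a (sg z) = g a z.
Proof.
move=> bf bg [dsg esg] gf fg fsg a z.
have t1 : trilin (fun z1 z2 z3 => g (f (g a (sg z1)) z2) z3) by lin.
have := coassoc z _ t1.
have -> : \sw_(z', z3 <- comul Z z) \sw_(z1, z2 <- comul Z z')
    g (f (g a (sg z1)) z2) z3 = g a z.
  rewrite -[RHS](counitL z (g a)); last by lin.
  peel z' z3; rewrite -(lin_tsumE _ _ (f := fun u => g u z3)); last by lin.
  have -> : \sw_(z1, z2 <- comul Z z') f (g a (sg z1)) z2 =
      (counit Z z' : k) *: a.
    rewrite -esg -fg dsg tsum_om; last by lin.
    by peel z1 z2; rewrite fsg.
  by apply: (lin_scaleE (f := g^~ z3)); lin.
move->; rewrite -[LHS](counitR z (fun z => g a (sg z))); last by lin.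
by peel z1 z'; rewrite gf.
Qed.

Section QCycle.
Variables (k : fieldType) (X : coalgebra k).
Variables (s : {linear X \ot X -> X \ot X}) (q : qpair X).
Hypothesis sq : dual s q.
Local Notation R := (ract s).
Local Notation L := (lact s).
Local Notation D := (qdot q).
Local Notation C := (qcolon q).
Implicit Types (U : lmodType k) (a b c p r x y z : X).

Let cRL := dual_crossing sq.
Let RK := dual_RK sq.
Let DK := dual_DK sq.

Definition braid1 : Prop := forall a b x, L (a \ox L (b \ox x)) =
  \sw_(u, v <- s (a \ox b)) L (u \ox L (v \ox x)).
Definition braid2 : Prop := forall a b x,
  \sw_(u, v <- s (a \ox b)) R (u \ox L (v \ox x)) =
  \sw_(u, v <- s (b \ox x)) L (R (a \ox u) \ox v).
Definition braid3 : Prop := forall a b x, R (R (a \ox b) \ox x) =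
  \sw_(u, v <- s (b \ox x)) R (R (a \ox u) \ox v).

Definition qcycle1 : Prop := forall x y z,
  \sw_(y1, y2 <- comul X y) D (D (x \ox y1) \ox C (z \ox y2)) =
  \sw_(z1, z2 <- comul X z) D (D (x \ox z2) \ox D (y \ox z1)).
Definition qcycle2 : Prop := forall x y z,
  \sw_(y1, y2 <- comul X y) C (D (x \ox y1) \ox D (z \ox y2)) =
  \sw_(z1, z2 <- comul X z) D (C (x \ox z2) \ox C (y \ox z1)).
Definition qcycle3 : Prop := forall x y z,
  \sw_(y1, y2 <- comul X y) C (C (x \ox y1) \ox C (z \ox y2)) =
  \sw_(z1, z2 <- comul X z) C (C (x \ox z2) \ox D (y \ox z1)).

(** The third braid equation: b (x) x acts on X by a |-> (a^b)^x, with convolution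
inverse a |-> (a . x) . b, and the equation is invariance of this action under
s. *)
Lemma braid3_dot : braid3 <-> forall a b x,
  D (D (a \ox x) \ox b) = \sw_(u, v <- s (b \ox x)) D (D (a \ox v) \ox u).
Proof.
pose f a (w : X \ot X) := \sw_(b, x <- w) R (R (a \ox b) \ox x).
pose g a (w : X \ot X) := \sw_(b, x <- w) D (D (a \ox x) \ox b).
have bf : bilin f by rewrite /f; lin.
have bg : bilin g by rewrite /g; lin.
have ms : coalg_morphism (tens X X) (tens X X) s by case: sq.
have fE a b x : f a (b \ox x) = R (R (a \ox b) \ox x).
  by rewrite /f tsum_pure //; lin.
have gE a b x : g a (b \ox x) = D (D (a \ox x) \ox b).
  by rewrite /g tsum_pure //; lin.
have scal a b x : (counit X x : k) *: ((counit X b : k) *: a) =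
    (tens_counit X X (b \ox x) : k) *: a.
  by rewrite tliftE scalerA mulrC.
have gf a w : \sw_(w1, w2 <- comul (tens X X) w) g (f a w1) w2 =
    (counit (tens X X) w : k) *: a.
  move: w; apply: tlin_ext => [||b x]; try by lin.
  rewrite tsum_comul_tens; last by lin.
  step (peel b1 b2; peel x1 x2; rewrite fE gE; reflexivity).
  step (peel b1 b2; apply: (cancel_legs RK (R (a \ox b1)) x
    (fun u => D (u \ox b2)))).
  rewrite -scal.
  rewrite -(lin_tsumE _ _ (f := fun u => (counit X x : k) *: u)); last by lin.
  by congr (_ *: _); apply: (cancel_legs RK a b (fun u => u)); lin.
have fg a w : \sw_(w1, w2 <- comul (tens X X) w) f (g a w1) w2 =
    (counit (tens X X) w : k) *: a.
  move: w; apply: tlin_ext => [||b x]; try by lin.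
  rewrite tsum_comul_tens; last by lin.
  rewrite tsum_exch.
  step (peel x1 x2; peel b1 b2; rewrite fE gE; reflexivity).
  step (peel x1 x2; apply: (cancel_legs DK (D (a \ox x1)) b
    (fun u => R (u \ox x2)))).
  rewrite -scal scalerA mulrC -scalerA.
  rewrite -(lin_tsumE _ _ (f := fun u => (counit X b : k) *: u)); last by lin.
  by congr (_ *: _); apply: (cancel_legs DK a x (fun u => u)); lin.
split=> H a b x.
  rewrite -gE -[RHS]/(g a (s (b \ox x))); symmetry.
  apply: (conv_inv_invariant (Z := tens X X) bf bg ms gf fg) => {b x}a'.
  by apply: tlin_ext => [||b x]; try (by lin); rewrite fE [RHS]H.
rewrite -fE -[RHS]/(f a (s (b \ox x))); symmetry.
apply: (conv_inv_invariant (Z := tens X X) bg bf ms fg gf) => {b x}a'.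
by apply: tlin_ext => [||b x]; try (by lin); rewrite gE [RHS]H.
Qed.

(** Substitute b (x) x := y . z_1 (x) z_2; then s(b (x) x) = z : y_2 (x) y_1. *)
Lemma braid3_qcycle1 : braid3 <-> qcycle1.
Proof.
rewrite braid3_dot; split=> H a.
  move=> y z.
  rewrite -(tsum_sol_dot sq y z (fun u v => D (D (a \ox v) \ox u))); last by lin.
  rewrite Gmap_tsum [in LHS]linear_tsum tsum_tsum; last by lin.
  by peel z1 z2; rewrite -H.
apply: (subst_Gmap RK) => [||y z]; [by lin|by lin|].
rewrite -[LHS]H.
rewrite -(tsum_sol_dot sq y z (fun u v => D (D (a \ox v) \ox u))); last by lin.
rewrite Gmap_tsum [in LHS]linear_tsum tsum_tsum; last by lin.
by peel z1 z2.
Qed.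

(** The second braid equation with its right-hand side rewritten by means of the
third one; see braid2_mixed. *)
Definition mixed : Prop := forall a b x,
  \sw_(b1, b2 <- comul X b) \sw_(x1, x2 <- comul X x)
    C (R (b2 \ox x2) \ox R (R (a \ox b1) \ox x1)) =
  \sw_(u, v <- s (a \ox b)) R (u \ox L (v \ox x)).

(** By the third braid equation (a^(b_1))^(x_1) is (a^u)^v for
u (x) v = s(b_1 (x) x_1), and v_2 : (a^u)^(v_1) = ^(a^u) v. *)
Lemma braid2_mixed : braid3 -> braid2 <-> mixed.
Proof.
move=> B3; suff E a b x : \sw_(b1, b2 <- comul X b) \sw_(x1, x2 <- comul X x)
    C (R (b2 \ox x2) \ox R (R (a \ox b1) \ox x1)) =
    \sw_(u, v <- s (b \ox x)) L (R (a \ox u) \ox v).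
  by split=> H a b x; [rewrite E H | rewrite -E H].
step (peel b1 b2; peel x1 x2; rewrite B3 tens_tsumr linear_tsum;
  reflexivity).
step (apply: (sol_comulr sq b x
  (F := fun u v w => C (w \ox R (R (a \ox u) \ox v))))).
by peel u v; apply: (colon_act sq (R (a \ox u)) v (fun w => w)); lin.
Qed.

(** The equation mixed after the substitution a := c . b_1, b := b_2. *)
Definition mixed_dot : Prop := forall c b x,
  \sw_(x1, x2 <- comul X x) C (R (b \ox x2) \ox R (c \ox x1)) =
  \sw_(c1, c2 <- comul X c) R (C (b \ox c2) \ox L (c1 \ox x)).

Lemma mixed_mixed_dot : mixed <-> mixed_dot.
Proof.
suff E x : (forall a b, \sw_(b1, b2 <- comul X b) \sw_(x1, x2 <- comul X x)
      C (R (b2 \ox x2) \ox R (R (a \ox b1) \ox x1)) =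
      \sw_(u, v <- s (a \ox b)) R (u \ox L (v \ox x))) <->
    (forall c b, \sw_(x1, x2 <- comul X x) C (R (b \ox x2) \ox R (c \ox x1)) =
      \sw_(c1, c2 <- comul X c) R (C (b \ox c2) \ox L (c1 \ox x))).
  split=> H.
    by move=> c b x; move: c b; apply/E => a b; apply: H.
  by move=> a b x; move: a b; apply/E => a b; apply: H.
rewrite (subst_Gmap_iff RK); [|by lin|by lin].
have E1 c b : \sw_(y1, y2 <- comul X b) \sw_(b1, b2 <- comul X y2)
      \sw_(x1, x2 <- comul X x)
      C (R (b2 \ox x2) \ox R (R (D (c \ox y1) \ox b1) \ox x1)) =
    \sw_(x1, x2 <- comul X x) C (R (b \ox x2) \ox R (c \ox x1)).
  apply: (cancel_legs3 DK c b (fun p r => \sw_(x1, x2 <- comul X x)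
    C (R (r \ox x2) \ox R (p \ox x1)))); lin.
have E2 c b : \sw_(y1, y2 <- comul X b)
      \sw_(u, v <- s (D (c \ox y1) \ox y2)) R (u \ox L (v \ox x)) =
    \sw_(c1, c2 <- comul X c) R (C (b \ox c2) \ox L (c1 \ox x)).
  rewrite -(tsum_sol_dot sq c b (fun u v => R (u \ox L (v \ox x)))); last by lin.
  by rewrite Gmap_tsum [in RHS]linear_tsum tsum_tsum; last by lin.
by split=> H c b; have := H c b; rewrite E1 E2.
Qed.

Definition qdots p r x :=
  \sw_(x1, x2 <- comul X x) C (D (p \ox x1) \ox D (r \ox x2)).

(** The second q-cycle identity solved for p : r.  On its right-hand side
x : r acts by the convolution inverse of the action in qcycle2. *)
Definition qcycle2_act : Prop := forall p r x,
  (counit X x : k) *: C (p \ox r) =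
  \sw_(r1, r2 <- comul X r) \sw_(x1, x2 <- comul X x)
    R (qdots p r2 x1 \ox C (x2 \ox r1)).

(** Substitute c := c . x_2 and b := b . x_1 in mixed_dot, x itself becoming
x_3. *)
Lemma mixed_dot_qcycle2_act : mixed_dot <-> qcycle2_act.
Proof.
pose fl c b x := \sw_(x1, x2 <- comul X x) C (R (b \ox x2) \ox R (c \ox x1)).
pose fr c b x := \sw_(c1, c2 <- comul X c) R (C (b \ox c2) \ox L (c1 \ox x)).
have E1 c b x : \sw_(x1, x' <- comul X x) \sw_(x2, x3 <- comul X x')
    fl (D (c \ox x2)) (D (b \ox x1)) x3 = (counit X x : k) *: C (b \ox c).
  rewrite /fl.
  step (peel x1 x'; apply: (cancel_legs3 DK c x'
    (fun p r => C (R (D (b \ox x1) \ox r) \ox p)))).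
  by apply: (cancel_legs DK b x (fun p => C (p \ox c))); lin.
have E2 c b x : \sw_(x1, x' <- comul X x) \sw_(x2, x3 <- comul X x')
    fr (D (c \ox x2)) (D (b \ox x1)) x3 =
    \sw_(c1, c2 <- comul X c) \sw_(x1, x2 <- comul X x)
    R (qdots b c2 x1 \ox C (x2 \ox c1)).
  rewrite /fr.
  step (peel x1 x'; peel x2 x3; apply: (tsum_comul_dot sq)).
  step (peel x1 x'; rewrite tsum_exch; reflexivity).
  rewrite tsum_exch; peel c1 c2.
  step (peel x1 x'; apply: (coassoc x' (fun x2 x3 x4 =>
     R (C (D (b \ox x1) \ox D (c2 \ox x2)) \ox L (D (c1 \ox x3) \ox x4))))).
  step (peel x1 x'; peel x2 x3; apply: (act_dot sq c1 x3 (fun u =>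
     R (C (D (b \ox x1) \ox D (c2 \ox x2)) \ox u)))).
  rewrite -(coassoc x (fun x1 x2 x3 =>
    R (C (D (b \ox x1) \ox D (c2 \ox x2)) \ox C (x3 \ox c1)))); last by lin.
  peel x1 x2.
  by rewrite /qdots (lin_tsumE _ _ (f := fun u => R (u \ox C (x2 \ox c1)))) //; lin.
have H1 b : (forall c x, fl c b x = fr c b x) <->
   (forall c x, \sw_(x2, x3 <- comul X x) fl (D (c \ox x2)) b x3 =
       \sw_(x2, x3 <- comul X x) fr (D (c \ox x2)) b x3).
  by apply: (subst_Gmap_iff RK); rewrite /fl /fr; lin.
have H2 c : (forall b x, \sw_(x2, x3 <- comul X x) fl (D (c \ox x2)) b x3 =
       \sw_(x2, x3 <- comul X x) fr (D (c \ox x2)) b x3) <->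
  (forall b x, \sw_(x1, x' <- comul X x) \sw_(x2, x3 <- comul X x')
    fl (D (c \ox x2)) (D (b \ox x1)) x3 =
    \sw_(x1, x' <- comul X x) \sw_(x2, x3 <- comul X x')
    fr (D (c \ox x2)) (D (b \ox x1)) x3).
  by apply: (subst_Gmap_iff RK); rewrite /fl /fr; lin.
split=> H.
  move=> b c x; rewrite -E1 -E2; move: b x; apply/H2 => b x.
  by move: c x; apply/H1 => c x; apply: H.
move=> c b x; rewrite -/(fl c b x) -/(fr c b x).
move: c x; apply/H1 => c x; move: b x; apply/H2 => b x.
by rewrite E1 E2.
Qed.

(** Act on both sides with the convolution inverse; the coproduct of x : r is
(x_1 : r_2) (x) (x_2 : r_1). *)
Lemma qcycle2_qcycle2_act : qcycle2 <-> qcycle2_act.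
Proof.
split=> H.
  move=> p r x.
  step (symmetry; apply: (counitL r (fun r => (counit X x : k) *: C (p \ox r)))).
  symmetry; step (peel r1 r2; peel x1 x2;
    rewrite [qdots _ _ _]H tens_tsuml linear_tsum; reflexivity).
  step (peel r1 r2; apply: tsum_exch).
  rewrite -(coassoc r (fun r1 r2 r3 => \sw_(x1, x2 <- comul X x)
    R (D (C (p \ox r3) \ox C (x1 \ox r2)) \ox C (x2 \ox r1)))); last by lin.
  peel r' r3.
  rewrite -(tsum_comul_colon sq x r'
    (fun w1 w2 => R (D (C (p \ox r3) \ox w1) \ox w2))); last by lin.
  rewrite (cancel_legs DK (C (p \ox r3)) (C (x \ox r')) (fun u => u));
    last by lin.
  by rewrite (counit_colon sq) mulrC scalerA.
move=> p x r; rewrite -/(qdots p r x).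
symmetry.
have H' r2 x1 (u : X) : (counit X x1 : k) *: D (C (p \ox r2) \ox u) =
    \sw_(r21, r22 <- comul X r2) \sw_(x11, x12 <- comul X x1)
     D (R (qdots p r22 x11 \ox C (x12 \ox r21)) \ox u).
  rewrite -[LHS](lin_scaleE (f := fun v => D (v \ox u))); last by lin.
  rewrite H (lin_tsumE _ _ (f := fun v => D (v \ox u))); last by lin.
  peel r21 r22.
  by rewrite (lin_tsumE _ _ (f := fun v => D (v \ox u))); last by lin.
step (peel r1 r2; symmetry;
  apply: (counitL x (fun x => D (C (p \ox r2) \ox C (x \ox r1))))).
step (peel r1 r2; peel x1 x2; apply: H').
step (peel r1 r2; apply: tsum_exch).
rewrite -(coassoc r (fun r1 r2 r3 =>
  \sw_(x1, x2 <- comul X x) \sw_(x11, x12 <- comul X x1)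
    D (R (qdots p r3 x11 \ox C (x12 \ox r2)) \ox C (x2 \ox r1))));
  last by rewrite /qdots; lin.
rewrite -[RHS](counitL r (fun r => qdots p r x)); last by rewrite /qdots; lin.
peel r' r3.
step (peel r1 r2; apply: (coassoc x (fun x1 x2 x3 =>
  D (R (qdots p r3 x1 \ox C (x2 \ox r2)) \ox C (x3 \ox r1)))); rewrite /qdots).
rewrite tsum_exch -(counitR x (qdots p r3)); last by rewrite /qdots; lin.
rewrite (lin_tsumE _ _ (f := fun u => (counit X r' : k) *: u)); last by lin.
peel x1 x'.
rewrite -(tsum_comul_colon sq x' r'
  (fun w1 w2 => D (R (qdots p r3 x1 \ox w1) \ox w2))); last by lin.
rewrite (cancel_legs RK (qdots p r3 x1) (C (x' \ox r')) (fun u => u));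
  last by lin.
by rewrite (counit_colon sq) mulrC scalerA.
Qed.

(** With y := (a^(b_1))^(x_1), z := b_2^(x_2) and x := x_3, the right-hand side of
the third q-cycle identity becomes ^a(^b x) by the third braid equation (E1), and
its left-hand side becomes ^u(^v x), with u (x) v = s(a (x) b), by mixed (E2). *)
Lemma braid1_qcycle3 : braid3 -> mixed -> braid1 <-> qcycle3.
Proof.
move=> B3 M.
pose fr y z x := \sw_(z1, z2 <- comul X z) C (C (x \ox z2) \ox D (y \ox z1)).
pose fl y z x := \sw_(y1, y2 <- comul X y) C (C (x \ox y1) \ox C (z \ox y2)).
have E1 a b x : \sw_(b1, b2 <- comul X b)
    \sw_(x1, x' <- comul X x) \sw_(x2, x3 <- comul X x')
    fr (R (R (a \ox b1) \ox x1)) (R (b2 \ox x2)) x3 = L (a \ox L (b \ox x)).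
  step (peel b1 b2; symmetry; apply: (coassoc x (fun x1 x2 x3 =>
    fr (R (R (a \ox b1) \ox x1)) (R (b2 \ox x2)) x3)); rewrite /fr).
  rewrite tsum_exch.
  step (peel x' x3; peel b1 b2; peel x1 x2; rewrite B3;
    apply: (lin_tsumE _ _ (f := fun y => fr y (R (b2 \ox x2)) x3)); rewrite /fr).
  step (peel x' x3; apply: (sol_comulr sq b x' (F := fun u w v =>
    fr (R (R (a \ox u) \ox w)) v x3)); rewrite /fr).
  step (peel x' x3; peel u w; apply: (cancel_legs3 RK (R (a \ox u)) w (fun p r =>
    C (C (x3 \ox r) \ox p)))).
  step (apply: (sol_colon sq b x (F := fun u v => C (v \ox R (a \ox u))))).
  by apply: (colon_act sq a (L (b \ox x)) (fun w => w)); lin.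
have E2 a b x : \sw_(b1, b2 <- comul X b)
    \sw_(x1, x' <- comul X x) \sw_(x2, x3 <- comul X x')
    fl (R (R (a \ox b1) \ox x1)) (R (b2 \ox x2)) x3 =
    \sw_(u, v <- s (a \ox b)) L (u \ox L (v \ox x)).
  rewrite /fl.
  step (peel b1 b2; peel x1 x'; peel x2 x3; apply: (tsum_dR cRL)).
  step (peel b1 b2; peel x1 x'; peel x2 x3; apply: (tsum_dR cRL)).
  (* Reorder the sums so that b2, b3 and x2, x3, the arguments of the inner C,
     become the coproducts of b' and x'', and mixed applies to a2, b', x''. *)
  step (peel b1 b2; peel x1 x'; apply: tsum_exch).
  step (peel b1 b2; apply: tsum_exch).
  rewrite tsum_exch.
  step (peel a1 a2; peel b1 b2; peel x1 x'; apply: tsum_exch).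
  step (peel a1 a2; peel b1 b2; apply: tsum_exch).
  step (peel a1 a2; apply: (coassoc b (fun b1 b2 b3 => \sw_(x1, x' <- comul X x)
    \sw_(x3, x4 <- comul X x') \sw_(x11, x12 <- comul X x1)
      C (C (x4 \ox R (R (a1 \ox b1) \ox x11)) \ox
         C (R (b3 \ox x3) \ox R (R (a2 \ox b2) \ox x12)))))).
  step (peel a1 a2; peel b1 b'; peel b2 b3; peel x1 x'; apply: tsum_exch).
  step (peel a1 a2; peel b1 b'; peel b2 b3; apply: (coassoc x (fun x1 x2 x3 =>
    \sw_(x4, x5 <- comul X x3)
      C (C (x5 \ox R (R (a1 \ox b1) \ox x1)) \ox
         C (R (b3 \ox x4) \ox R (R (a2 \ox b2) \ox x2)))))).
  step (peel a1 a2; peel b1 b'; peel b2 b3; peel x1 x'; symmetry;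
    apply: (coassoc x' (fun x2 x3 x4 =>
      C (C (x4 \ox R (R (a1 \ox b1) \ox x1)) \ox
         C (R (b3 \ox x3) \ox R (R (a2 \ox b2) \ox x2)))))).
  step (peel a1 a2; peel b1 b'; apply: tsum_exch).
  step (peel a1 a2; peel b1 b'; peel x1 x'; apply: tsum_exch).
  pose H a1 b1 x1 x4 u := C (C (x4 \ox R (R (a1 \ox b1) \ox x1)) \ox u).
  transitivity (\sw_(a1, a2 <- comul X a) \sw_(b1, b' <- comul X b)
    \sw_(x1, x' <- comul X x) \sw_(x'', x4 <- comul X x')
    \sw_(u, v <- s (a2 \ox b')) H a1 b1 x1 x4 (R (u \ox L (v \ox x'')))).
    peel a1 a2; peel b1 b'; peel x1 x'; peel x'' x4.
    have lH : linear (H a1 b1 x1 x4) by rewrite /H; lin.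
    rewrite -(lin_tsumE _ _ lH) -M (lin_tsumE _ _ lH); peel b2 b3.
    by rewrite (lin_tsumE _ _ lH).
  step (peel a1 a2; peel b1 b'; peel x1 x'; apply: tsum_exch).
  step (peel a1 a2; peel b1 b'; apply: tsum_exch).
  rewrite /H {H}.
  step (apply: (sol_comulm sq a b (F := fun u v w => \sw_(x1, x' <- comul X x)
    \sw_(x2, x3 <- comul X x')
      C (C (x3 \ox R (v \ox x1)) \ox R (u \ox L (w \ox x2)))))).
  peel u v.
  step (apply: (tsum_LR_swap_leg cRL v x
    (fun l r x3 => C (C (x3 \ox r) \ox R (u \ox l))))).
  step (peel v1 v2; peel x1 x'; apply: (colon_act sq v2 x' (fun w =>
    C (w \ox R (u \ox L (v1 \ox x1)))))).
  rewrite -(tsum_comulL cRL v x (fun l w => C (w \ox R (u \ox l))));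
    last by lin.
  by apply: (colon_act sq u (L (v \ox x)) (fun w => w)); lin.
(* Three successive substitutions produce the arguments of E1 and E2. *)
have H1 y : (forall z x, fl y z x = fr y z x) <->
   (forall z x, \sw_(x1, x2 <- comul X x) fl y (R (z \ox x1)) x2 =
                \sw_(x1, x2 <- comul X x) fr y (R (z \ox x1)) x2).
  by apply: (subst_Gmap_iff DK); rewrite /fl /fr; lin.
have H2 z : (forall y x, \sw_(x1, x2 <- comul X x) fl y (R (z \ox x1)) x2 =
                \sw_(x1, x2 <- comul X x) fr y (R (z \ox x1)) x2) <->
  (forall y x, \sw_(x1, x' <- comul X x) \sw_(x2, x3 <- comul X x')
       fl (R (y \ox x1)) (R (z \ox x2)) x3 =
     \sw_(x1, x' <- comul X x) \sw_(x2, x3 <- comul X x')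
       fr (R (y \ox x1)) (R (z \ox x2)) x3).
  by apply: (subst_Gmap_iff DK); rewrite /fl /fr; lin.
have H3 x : (forall y z, \sw_(x1, x' <- comul X x) \sw_(x2, x3 <- comul X x')
       fl (R (y \ox x1)) (R (z \ox x2)) x3 =
     \sw_(x1, x' <- comul X x) \sw_(x2, x3 <- comul X x')
       fr (R (y \ox x1)) (R (z \ox x2)) x3) <->
  (forall a b, \sw_(b1, b2 <- comul X b)
     \sw_(x1, x' <- comul X x) \sw_(x2, x3 <- comul X x')
       fl (R (R (a \ox b1) \ox x1)) (R (b2 \ox x2)) x3 =
     \sw_(b1, b2 <- comul X b)
     \sw_(x1, x' <- comul X x) \sw_(x2, x3 <- comul X x')
       fr (R (R (a \ox b1) \ox x1)) (R (b2 \ox x2)) x3).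
  by apply: (subst_Gmap_iff DK); rewrite /fl /fr; lin.
split=> H.
  move=> x y z; rewrite -/(fl y z x) -/(fr y z x).
  move: z x; apply/H1 => z x; move: y x; apply/H2 => y x.
  move: y z; apply/H3 => a b.
  by rewrite E1 E2.
move=> a b x; rewrite -E1 -E2; symmetry; move: a b; apply/H3 => y z.
by move: y x; apply/H2 => y x; move: z x; apply/H1 => z x; apply: H.
Qed.

End QCycle.

(** * Components of the braid equation *)

Section Braid.
Variables (k : fieldType) (X : coalgebra k) (s : {linear X \ot X -> X \ot X}).
Hypothesis ms : coalg_morphism (tens X X) (tens X X) s.
Local Notation R := (ract s).
Local Notation L := (lact s).
Local Notation X3 := (tens (tens X X) X).

Let s12 : {linear X \ot X \ot X -> X \ot X \ot X} := s \om idfun.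
Let s23 : {linear X \ot X \ot X -> X \ot X \ot X} :=
  tassocV \o (idfun \om s) \o tassoc.

Let ms12 : coalg_morphism X3 X3 s12.
Proof. exact: (tmap_morphism ms (idfun_morphism X)). Qed.

Let ms23 : coalg_morphism X3 X3 s23.
Proof.
apply: (coalg_morphism_comp (tassoc_morphism X X X)).
apply: (coalg_morphism_comp (B := tens X (tens X X)) _ (tassocV_morphism X X X)).
exact: (tmap_morphism (idfun_morphism X) ms).
Qed.

Let p3 : {linear X \ot X \ot X -> X} := tcontractl (tens_counit X X).
Let p12 : {linear X \ot X \ot X -> X \ot X} := tcontractr (counit X).
Let p1 : {linear X \ot X \ot X -> X} := tcontractr (counit X) \o p12.
Let p2 : {linear X \ot X \ot X -> X} := tcontractl (counit X) \o p12.

Let s12E x y z :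
  s12 (x \ox y \ox z) = \sw_(u, v <- s (x \ox y)) (u \ox v) \ox z.
Proof. by rewrite /s12 tmapE /= -[s _ in LHS]tsum_tens tens_tsuml. Qed.

Let s23E x y z :
  s23 (x \ox y \ox z) = \sw_(u, v <- s (y \ox z)) (x \ox u) \ox v.
Proof.
rewrite -[LHS]/(tassocV ((idfun \om s) (tassoc _))) tassocE tmapE.
rewrite -[s _ in LHS]tsum_tens tens_tsumr linear_tsum.
by peel u v; rewrite tassocVE.
Qed.

Let tri_ext (V : lmodType k) (f g : {linear X \ot X \ot X -> V}) :
  (forall x y z, f (x \ox y \ox z) = g (x \ox y \ox z)) -> f =1 g.
Proof.
move=> fg; apply: tlin_ext => [||t z]; try by lin.
by move: t; apply: tlin_ext => [||x y]; try by lin.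
Qed.

Let LE t : \sw_(u, v <- s t) (counit X v : k) *: u = L t.
Proof.
rewrite -[RHS]/(tcontractr _ (s t)) -[s t in RHS]tsum_tens linear_tsum.
by peel u v; rewrite tcontractrE.
Qed.

Let RE t : \sw_(u, v <- s t) (counit X u : k) *: v = R t.
Proof.
rewrite -[RHS]/(tcontractl _ (s t)) -[s t in RHS]tsum_tens linear_tsum.
by peel u v; rewrite tcontractlE.
Qed.

Let p1E x y z : p1 (x \ox y \ox z) = (counit X z : k) *: ((counit X y : k) *: x).
Proof. by rewrite /p1 /= /p12 tcontractrE linearZ_LR tcontractrE. Qed.
Let p2E x y z : p2 (x \ox y \ox z) = (counit X z : k) *: ((counit X x : k) *: y).
Proof. by rewrite /p2 /= /p12 tcontractrE linearZ_LR tcontractlE. Qed.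
Let p3E x y z : p3 (x \ox y \ox z) = (counit X y : k) *: ((counit X x : k) *: z).
Proof. by rewrite /p3 tcontractlE tliftE scalerA mulrC. Qed.

(** Both sides of the braid equation are coalgebra morphisms, so that it suffices
to compare their three components.  They are computed from the outside: s12 does
not change the third component, nor s23 the first. *)
Lemma braid_components :
  braid_equation s <-> [/\ braid1 s, braid2 s & braid3 s].
Proof.
have [_ es] := ms.
have epsE (U : lmodType k) t (w : U) :
    \sw_(u, v <- s t) (counit X v : k) *: ((counit X u : k) *: w) =
    (tens_counit X X t : k) *: w.
  rewrite -es -[s t in RHS]tsum_tens linear_tsum.
  rewrite (lin_tsumE _ _ (f := fun c : k^o => (c : k) *: w)); last first.
    by move=> a x y; rewrite scalerDl scalerA.
  by peel u v; rewrite tliftE scalerA mulrC.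
have p1s12 x y z : p1 (s12 (x \ox y \ox z)) = (counit X z : k) *: L (x \ox y).
  rewrite s12E !linear_tsum -LE.
  rewrite (lin_tsumE _ _ (f := fun w => (counit X z : k) *: w)); last by lin.
  by peel u v; rewrite p1E.
have p2s12 x y z : p2 (s12 (x \ox y \ox z)) = (counit X z : k) *: R (x \ox y).
  rewrite s12E !linear_tsum -RE.
  rewrite (lin_tsumE _ _ (f := fun w => (counit X z : k) *: w)); last by lin.
  by peel u v; rewrite p2E.
have p2s23 x y z : p2 (s23 (x \ox y \ox z)) = (counit X x : k) *: L (y \ox z).
  rewrite s23E !linear_tsum -LE.
  rewrite (lin_tsumE _ _ (f := fun w => (counit X x : k) *: w)); last by lin.
  by peel u v; rewrite p2E scalerA mulrC -scalerA.
have p3s23 x y z : p3 (s23 (x \ox y \ox z)) = (counit X x : k) *: R (y \ox z).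
  rewrite s23E !linear_tsum -RE.
  rewrite (lin_tsumE _ _ (f := fun w => (counit X x : k) *: w)); last by lin.
  by peel u v; rewrite p3E scalerA mulrC -scalerA.
have p1s23 t : p1 (s23 t) = p1 t.
  move: t; apply: (tri_ext (f := p1 \o s23) (g := p1)) => x y z.
  rewrite -[LHS]/(p1 (s23 _)) s23E !linear_tsum p1E.
  step (peel u v; apply: p1E).
  by rewrite epsE tliftE scalerA mulrC.
have p3s12 t : p3 (s12 t) = p3 t.
  move: t; apply: (tri_ext (f := p3 \o s12) (g := p3)) => x y z.
  rewrite -[LHS]/(p3 (s12 _)) s12E !linear_tsum p3E.
  step (peel u v; apply: p3E).
  by rewrite epsE tliftE scalerA mulrC.
have e1 x y z : p1 (s12 (s23 (x \ox y \ox z))) = L (x \ox L (y \ox z)).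
  rewrite s23E !linear_tsum -[L (y \ox z)]LE tens_tsumr linear_tsum.
  by peel u v; rewrite p1s12 tscaler linearZ_LR.
have e2 x y z : p2 (s12 (s23 (x \ox y \ox z))) = R (x \ox L (y \ox z)).
  rewrite s23E !linear_tsum -LE tens_tsumr linear_tsum.
  by peel u v; rewrite p2s12 tscaler linearZ_LR.
have e2' x y z : p2 (s23 (s12 (x \ox y \ox z))) = L (R (x \ox y) \ox z).
  rewrite s12E !linear_tsum -RE tens_tsuml linear_tsum.
  by peel u v; rewrite p2s23 tscalel linearZ_LR.
have e3 x y z : p3 (s23 (s12 (x \ox y \ox z))) = R (R (x \ox y) \ox z).
  rewrite s12E !linear_tsum -[R (x \ox y)]RE tens_tsuml linear_tsum.
  by peel u v; rewrite p3s23 tscalel linearZ_LR.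
have E1 x y z : p1 (s12 (s23 (s12 (x \ox y \ox z)))) =
    \sw_(u, v <- s (x \ox y)) L (u \ox L (v \ox z)).
  by rewrite s12E !linear_tsum; peel u v; rewrite e1.
have E1' x y z : p1 (s23 (s12 (s23 (x \ox y \ox z)))) = L (x \ox L (y \ox z)).
  by rewrite p1s23 e1.
have E2 x y z : p2 (s12 (s23 (s12 (x \ox y \ox z)))) =
    \sw_(u, v <- s (x \ox y)) R (u \ox L (v \ox z)).
  by rewrite s12E !linear_tsum; peel u v; rewrite e2.
have E2' x y z : p2 (s23 (s12 (s23 (x \ox y \ox z)))) =
    \sw_(u, v <- s (y \ox z)) L (R (x \ox u) \ox v).
  by rewrite s23E !linear_tsum; peel u v; rewrite e2'.
have E3 x y z : p3 (s12 (s23 (s12 (x \ox y \ox z)))) = R (R (x \ox y) \ox z).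
  by rewrite p3s12 e3.
have E3' x y z : p3 (s23 (s12 (s23 (x \ox y \ox z)))) =
    \sw_(u, v <- s (y \ox z)) R (R (x \ox u) \ox v).
  by rewrite s23E !linear_tsum; peel u v; rewrite e3.
split=> [br | [B1 B2 B3]].
  split=> x y z.
  - by rewrite -E1' -br E1.
  - by rewrite -E2' -br E2.
  - by rewrite -E3' -br E3.
pose f : {linear X \ot X \ot X -> X \ot X \ot X} := s12 \o (s23 \o s12).
pose g : {linear X \ot X \ot X -> X \ot X \ot X} := s23 \o (s12 \o s23).
have mf : coalg_morphism X3 X3 f.
  exact: (coalg_morphism_comp (coalg_morphism_comp ms12 ms23) ms12).
have mg : coalg_morphism X3 X3 g.
  exact: (coalg_morphism_comp (coalg_morphism_comp ms23 ms12) ms23).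
apply: (morphism_ext mf mg) => t.
  have m12 := proj1_morphism (tens X X) X.
  have mpf := coalg_morphism_comp mf m12.
  have mpg := coalg_morphism_comp mg m12.
  move: t; apply: (morphism_ext mpf mpg).
    apply: (tri_ext (f := p1 \o f) (g := p1 \o g)) => x y z.
    by rewrite -[LHS]/(p1 (s12 (s23 (s12 _)))) E1
      -[RHS]/(p1 (s23 (s12 (s23 _)))) E1'.
  apply: (tri_ext (f := p2 \o f) (g := p2 \o g)) => x y z.
  by rewrite -[LHS]/(p2 (s12 (s23 (s12 _)))) E2
      -[RHS]/(p2 (s23 (s12 (s23 _)))) E2'.
move: t; apply: (tri_ext (f := p3 \o f) (g := p3 \o g)) => x y z.
by rewrite -[LHS]/(p3 (s12 (s23 (s12 _)))) E3
      -[RHS]/(p3 (s23 (s12 (s23 _)))) E3'.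
Qed.

End Braid.

(** * Regularity and non-degeneracy *)

Lemma bij_eq (T T' : Type) (f g : T -> T') :
  f =1 g -> bijective f <-> bijective g.
Proof.
by move=> fg; split=> h; apply: (eq_bij h) => t; rewrite fg.
Qed.

Section Regularity.
Variables (k : fieldType) (X : coalgebra k).

Variables (s : {linear X \ot X -> X \ot X}) (q : qpair X).
Hypothesis sq : dual s q.
Local Notation R := (ract s).
Local Notation L := (lact s).
Local Notation D := (qdot q).
Local Notation C := (qcolon q).
Implicit Types (a b x y : X).

Let RK := dual_RK sq.
Let DK := dual_DK sq.
Let ms : coalg_morphism (tens X X) (tens X X) s. Proof. by case: sq. Qed.
(* x (x) y |-> ^(y_2) x (x) y_1 *)
Let Hmap : {linear X \ot X -> X \ot X} := @Gmap k (cop X) (L \o tswap).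
(* x (x) y |-> x : y_2 (x) y_1 *)
Let K : {linear X \ot X -> X \ot X} := @Gmap k (cop X) C.

Lemma regular_bijective : bijective s <-> qregular q.
Proof.
have bR : bijective (Gmap R) by exists (Gmap D).
have bD : bijective (Gmap D) by exists (Gmap R).
have sE : s =1 K \o (tswap \o Gmap R) by move=> t; apply: (sol_factor sq).
have KE : K =1 s \o (Gmap D \o tswap).
  by move=> t; rewrite /= (sol_factor sq) DK tswapK.
split=> [bs | [_ bK]].
  split=> //; apply/(bij_eq KE); apply: bij_comp => //.
  by apply: bij_comp => //; apply: tswap_bij.
apply/(bij_eq sE); apply: bij_comp => //; apply: bij_comp => //.
exact: tswap_bij.
Qed.

Lemma right_nondeg_Hmap : right_nondeg s <-> bijective Hmap.
Proof.
have eH : @ract k (cop X) (tswap \o s \o tswap) = L \o tswap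
    :> {linear X \ot X -> X}.
  by apply: linear_ext => t; apply: tcontractl_swap.
rewrite /right_nondeg /left_nondeg eH; split=> [[]// | bH]; split=> //.
apply: (coalg_morphism_comp (tswap_morphism (cop X) (cop X))).
by apply: (coalg_morphism_comp (cop_morphism ms)); apply: tswap_morphism.
Qed.

Lemma qright_nondeg_Hmap : qright_nondeg q <-> bijective Hmap.
Proof.
have [_ lr] := dual_qmagma sq.
have eR : qract q = R.
  apply: Gmap_inj => t; have [DK' _] := Gmap_linv lr.
  by rewrite -[t]RK DK' RK.
have eL : qlact q = L.
  apply: linear_ext => t; rewrite /qlact eR.
  by case: sq => _ _ _ CE; apply: CE.
by rewrite /qright_nondeg eL; split=> [[] | ].
Qed.

Hypothesis bs : bijective s.

(** With qlsub_sol: the components of the inverse of s are _x y and x_y. *)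
Let qrsub_sol x y : qrsub q (s (x \ox y)) = (counit X x : k) *: y.
Proof.
have [_ bK] := regular_bijective.1 bs.
have [KK _] := linvP bK.
rewrite /qrsub /= (sol_factor sq) KK tcontractr_swap Gmap_tsum linear_tsum.
step (peel y1 y2; apply: tcontractlE).
have [eR _ _ _ _] := dual_crossing sq.
step (peel y1 y2; rewrite eR -scalerA; reflexivity).
rewrite -[in RHS](counitL y (fun y => y)); last by lin.
by rewrite (lin_tsumE _ _ (f := fun u => (counit X x : k) *: u)) //; lin.
Qed.

Let qlsub_sol x y : qlsub q (s (x \ox y)) = (counit X y : k) *: x.
Proof.
rewrite -[s _]tsum_tens linear_tsum.
step (peel u v; rewrite qlsubE; reflexivity).
step (symmetry; apply: (sol_comulm sq x y
  (F := fun u v w => D (v \ox qrsub q (u \ox w))))).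
step (peel x1 x2; peel y1 y2; symmetry;
  apply: (lin_tsumE (s (x2 \ox y2)) (fun u v => u \ox v)
  (f := fun w => D (R (x1 \ox y1) \ox qrsub q w)))).
step (peel x1 x2; peel y1 y2;
  rewrite tsum_tens qrsub_sol tscaler linearZ_LR; reflexivity).
step (apply: tsum_exch).
step (peel y1 y2; apply: (counitR x (fun x => D (R (x \ox y1) \ox y2)))).
by rewrite (cancel_legs RK x y (fun u => u)) //; lin.
Qed.

(** Composing P : x (x) y |-> _(y_1) x (x) y_2 with tau o s gives
x (x) y |-> x_1 (x) ^(x_2) y, which is Hmap conjugated by tau. *)
Lemma qleft_nondeg_Hmap : qleft_nondeg q <-> bijective Hmap.
Proof.
have [_ rr] := regular_bijective.1 bs.
pose P : {linear X \ot X -> X \ot X} := Gmap (qlsub q \o tswap).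
have PE : P \o (tswap \o s) =1 tswap \o (Hmap \o tswap).
  apply: (tlin_ext (f := (P \o (tswap \o s) : {linear _ -> _}))
    (g := (tswap \o (Hmap \o tswap) : {linear _ -> _}))) => [||x y]; try by lin.
  transitivity (\sw_(x1, x2 <- comul X x) x1 \ox L (x2 \ox y)); last first.
    rewrite -[RHS]/(tswap (Hmap (tswap (x \ox y)))) tswapE.
    rewrite Gmap_cop_tsum linear_tsum.
    by peel x1 x2; rewrite /= !tswapE.
  rewrite -[LHS]/(P (tswap (s (x \ox y)))) -[s _]tsum_tens !linear_tsum.
  step (peel u v; rewrite tswapE Gmap_tsum; reflexivity).
  step (peel u v; peel u1 u2;
    rewrite -[LHS]/(qlsub q (tswap (v \ox u1)) \ox u2) tswapE; reflexivity).
  step (symmetry; apply: (sol_comull sq x y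
    (F := fun u1 u2 v => qlsub q (u1 \ox v) \ox u2))).
  step (peel x1 x2; peel y1 y2; symmetry;
    apply: (lin_tsumE (s (x1 \ox y1)) (fun u v => u \ox v)
    (f := fun w => qlsub q w \ox L (x2 \ox y2)))).
  step (peel x1 x2; peel y1 y2; rewrite tsum_tens qlsub_sol tscalel;
    reflexivity).
  by peel x1 x2; rewrite (counitL y (fun y => x1 \ox L (x2 \ox y))) //; lin.
have [s' sK s'K] : bijective (tswap \o s).
  by apply: bij_comp => //; apply: tswap_bij.
have b2 := tswap_bij X X.
split=> [[_ bP] | bH].
  have b3 : bijective (tswap \o (Hmap \o tswap)).
    by apply/(bij_eq PE); apply: bij_comp => //; exists s'.
  have : Hmap =1 tswap \o ((tswap \o (Hmap \o tswap)) \o tswap).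
    by move=> t; rewrite /= !tswapK.
  by move/bij_eq => ->; apply: bij_comp => //; apply: bij_comp.
split=> //; have -> : bijective P <-> bijective ((P \o (tswap \o s)) \o s').
  by apply: bij_eq => t; rewrite /= -[in LHS](s'K t).
apply: bij_comp; last by exists (tswap \o s).
by apply/(bij_eq PE); apply: bij_comp => //; apply: bij_comp.
Qed.

End Regularity.

(** The implications between the braid equations and the q-cycle identities are
conditional on the earlier ones, so that they are chained in the order third,
second, first. *)
Lemma dual_braid (k : fieldType) (X : coalgebra k)
    (s : {linear X \ot X -> X \ot X}) (q : qpair X) : dual s q ->
  braid_equation s <-> [/\ qcycle1 q, qcycle2 q & qcycle3 q].
Proof.
move=> sq; have [ms _ _ _] := sq.
rewrite (braid_components ms); split=> -[].
  move=> B1 B2 B3; have M := (braid2_mixed sq B3).1 B2; split.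
  - exact/(braid3_qcycle1 sq).
  - apply/(qcycle2_qcycle2_act sq)/(mixed_dot_qcycle2_act sq).
    exact/(mixed_mixed_dot sq).
  - exact/(braid1_qcycle3 sq).
move=> Q1 Q2 Q3; have B3 := (braid3_qcycle1 sq).2 Q1.
have M : mixed s q.
  apply/(mixed_mixed_dot sq)/(mixed_dot_qcycle2_act sq).
  exact/(qcycle2_qcycle2_act sq).
split=> //; [exact/(braid1_qcycle3 sq) | exact/(braid2_mixed sq)].
Qed.

Local Open Scope classical_set_scope.

Theorem corollary4p12 (k : fieldType) (X : coalgebra k) :
  [/\ set_bij
        [set s : {linear X \ot X -> X \ot X} |
          braid_solution s /\ left_nondeg s]
        [set q : qpair X | qcycle_coalgebra q]
        (fun s => qpair_of s),
      forall s : {linear X \ot X -> X \ot X},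
        braid_solution s -> left_nondeg s ->
        (bijective s <-> qregular (qpair_of s))
    & forall s : {linear X \ot X -> X \ot X},
        braid_solution s -> left_nondeg s ->
        (bijective s /\ nondeg s <-> qnondeg (qpair_of s))].
Proof.
split.
- split.
  + move=> s [[ms br] nd]; have sq := dual_of_left_nondeg nd.
    have [qm lr] := dual_qmagma sq.
    by have [Q1 Q2 Q3] := (dual_braid sq).1 br.
  + move=> s s' /[!inE] -[_ nd] [_ nd'] e.
    apply: (dual_inj (dual_of_left_nondeg nd)).
    by rewrite e; apply: dual_of_left_nondeg.
  + move=> q [qm lr Q1 Q2 Q3]; have [s sq] := dual_of_qmagma qm lr.
    exists s; last exact: dual_qpair_of.
    split; last exact: dual_left_nondeg sq.
    split; first by case: sq.
    exact/(dual_braid sq).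
- by move=> s _ nd; apply/regular_bijective/dual_of_left_nondeg.
- move=> s _ nd; have sq := dual_of_left_nondeg nd.
  split=> [[bs [_ /(right_nondeg_Hmap sq) bH]] | [ln rn]].
    by split; [apply/(qleft_nondeg_Hmap sq bs) | apply/(qright_nondeg_Hmap sq)].
  have bs : bijective s.
    by apply/(regular_bijective sq); split; [case: rn | case: ln].
  split=> //; split=> //; apply/(right_nondeg_Hmap sq).
  exact/(qright_nondeg_Hmap sq).
Qed.
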